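(* Let $H$ be a fixed connected finite simple graph with no leaves, with $t$ vertices and $k$ edges, and let all objects be as in the context. Suppose $\mathcal{G}$ is either the group of complex $r$-th roots of unity for some integer $r\ge 2$ (viewed as $1\times 1$ matrices, so $d=1$), or the group $\{\pm I,\pm M,\pm M^2,\dots,\pm M^{d-1}\}$ for some $d\ge 2$. Suppose that the maximum degree $\Delta$ of any vertex of $G$ is at most $m^{1/2-\alpha}$, where $\alpha>0$, and that $t\le C\le\min(m^{2\alpha},m^{1/3})$. Then the estimator $$\frac{C^t}{C(C-1)\cdots(C-t+1)}\cdot\frac{\mathrm{tr}(\mathcal{S})}{d\cdot \mathrm{auto}(H)}$$ has variance $O\big((\#H)^2+m^k/(dC^{2k-t})\big)$, where the implied constant depends only on $H$.
   Context: Orient each edge of $H$ arbitrarily, obtaining $\vec H$ with vertices $1,\dots,t$ and directed edges $\overrightarrow{a_1a_2},\dots,\overrightarrow{a_{2k-1}a_{2k}}$, $a_i\in\{1,\dots,t\}$. For a vertex $b$ of $H$ let $\Gamma(b)=\{i\in\{1,\dots,2k\}:a_i=b\}$. For each $b$ fix one index $\iota(b)\in\Gamma(b)$, called distinguished. $G$ is a finite simple undirected graph; $\vec G$ is obtained by replacing each edge $vw$ of $G$ by the two directed edges $\overrightarrow{vw},\overrightarrow{wv}$; $m$ is the number of edges of $\vec G$. $\#H$ is the number of subgraphs of $G$ isomorphic to $H$, and $\mathrm{auto}(H)$ the number of automorphisms of $H$. $I$ is the $d\times d$ identity; $M$ is the $d\times d$ diagonal matrix with diagonal $1,\omega,\dots,\omega^{d-1}$,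 $\omega=e^{2\pi i/d}$. Hash functions $\mathcal X_1,\dots,\mathcal X_{2k}:V(G)\to\mathcal G$: for each non-distinguished $i$, $\mathcal X_i$ is chosen independently and uniformly from a $4k$-wise independent family, each value uniform on $\mathcal G$; for $i=\iota(b)$, $\mathcal X_i(v)=\prod_{j\in\Gamma(b),j\neq i}\mathcal X_j(v)^{-1}$ (equal to $I$ if $\Gamma(b)=\{i\}$). For an edge $\overrightarrow{vw}$ of $\vec G$ set $\mathcal M_i(\overrightarrow{vw})=\mathcal X_{2i-1}(v)\mathcal X_{2i}(w)$, $1\le i\le k$. A coloring $\mathcal C:V(G)\to\{1,\dots,C\}$ is chosen uniformly from a $4k$-wise independent family of hash functions, each value uniform. Define $\mathcal Z_i^{c_1,c_2}=\sum\mathcal M_i(\overrightarrow{vw})$ over edges $\overrightarrow{vw}$ of $\vec G$ with $\mathcal C(v)=c_1,\mathcal C(w)=c_2$; $\mathcal S_{(c_1,\dots,c_t)}=\prod_{i=1}^k\mathcal Z_i^{c_{a_{2i-1}},c_{a_{2i}}}$; and $\mathcal S=\sum\mathcal S_{(c_1,\dots,c_t)}$ over all $t$-tuples of pairwise distinct colors. Randomness is over the choice of the $\mathcal X_i$ and $\mathcal C$. *)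

(* Defs.v *)
From HB Require Import structures.
From mathcomp Require Import all_boot all_order all_fingroup all_algebra.
From mathcomp Require Import finmap.
From mathcomp Require Import reals exp trigo.
From mathcomp Require Export complex.

Set Implicit Arguments.
Unset Strict Implicit.
Unset Printing Implicit Defensive.

Import Order.TTheory GRing.Theory Num.Theory.

Local Open Scope ring_scope.
Local Open Scope complex_scope.

Section Graphs.
Local Open Scope nat_scope.

Definition simple_graph (T : finType) (e : rel T) :=
  symmetric e /\ irreflexive e.

Definition edge_set (T : finType) (e : rel T) : {set {set T}} :=
  [set [set p.1; p.2] | p : T * T & e p.1 p.2].

Definition directed_edges (T : finType) (e : rel T) : {set T * T} :=
  [set p | e p.1 p.2].

Definition degree (T : finType) (e : rel T) (v : T) : nat :=
  #|[set w | e v w]|.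

Definition max_degree (T : finType) (e : rel T) : nat := \max_v degree e v.

Definition connected_graph (T : finType) (e : rel T) :=
  0 < #|T| /\ forall x y, connect e x y.

Definition no_leaves (T : finType) (e : rel T) := forall v, degree e v != 1.

(* A subgraph is a pair (vertex set, edge set); it need not be induced. *)
Definition is_subgraph (V : finType) (g : rel V)
    (S : {set V} * {set {set V}}) : bool :=
  (S.2 \subset edge_set g) && [forall e in S.2, e \subset S.1].

Definition subgraph_iso (T V : finType) (h : rel T)
    (S : {set V} * {set {set V}}) : bool :=
  [exists f : {ffun T -> V},
    [&& injectiveb f, S.1 == [set f x | x : T]
      & [forall x, forall y, h x y == ([set f x; f y] \in S.2)]]].

Definition subgraph_count (T V : finType) (h : rel T) (g : rel V) : nat :=
  #|[set S | is_subgraph g S && subgraph_iso h S]|.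

Definition auto_count (T : finType) (h : rel T) : nat :=
  #|[set s : {perm T} | [forall x, forall y, h (s x) (s y) == h x y]]|.

End Graphs.

(* The endpoints a_1, ..., a_(2k) of the oriented edges are indexed by        *)
(* 'I_k * bool: with edges numbered from 0, (i, false) and (i, true) are the  *)
(* tail and the head of edge i, i.e. the indices 2i+1 and 2i+2.               *)
Definition slot (k : nat) : finType := ('I_k * bool)%type.

(* Every edge of h occurs exactly once among the k oriented edges. *)
Definition is_orientation (t k : nat) (h : rel 'I_t) (a : slot k -> 'I_t) :=
  let edge (i : 'I_k) := [set a (i, false); a (i, true)] in
  injective edge /\ [set edge i | i : 'I_k] = edge_set h.

Definition Gamma (t k : nat) (a : slot k -> 'I_t) (b : 'I_t) : {set slot k} :=
  [set i | a i == b].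

(* The non-distinguished indices, as a type. *)
Definition free_slot (t k : nat) (a : slot k -> 'I_t) (iota : 'I_t -> slot k)
  : finType := {i : slot k | i != iota (a i)}.

Section Probability.
Variable R : realType.

(* Probability, expectation and variance under the uniform distribution. *)
Definition Pr (Om : finType) (E : pred Om) : R := #|E|%:R / #|Om|%:R.

Definition expectation (Om : finType) (X : Om -> R[i]) : R[i] :=
  (\sum_w X w) / #|Om|%:R.

Definition variance (Om : finType) (X : Om -> R[i]) : R[i] :=
  expectation (fun w => `|X w - expectation X| ^+ 2).

(* A family of functions V -> A, possibly with repetitions, indexed by a     *)
(* finite type; a random member is given by a uniformly random index.        *)
Record hash_family (V : finType) (A : Type) := HashFamily {
  seed : finType;
  hash : seed -> V -> A }.

(* Subsets with fewer than n points are included so that the condition is    *)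
(* meaningful when V itself has fewer than n points.                         *)
Definition kwise_independent (n : nat) (V : finType) (A : eqType)
    (F : hash_family V A) :=
  forall (D : {set V}) (y : V -> A), (#|D| <= n)%N ->
    Pr [pred s : seed F | [forall v in D, hash s v == y v]] =
    \prod_(v in D) Pr [pred s : seed F | hash s v == y v].

Definition uniform_on (V : finType) (A : choiceType) (B : {fset A})
    (F : hash_family V A) :=
  forall (v : V) (x : A), x \in B ->
    Pr [pred s : seed F | hash s v == x] = (#|` B|%:R)^-1.

End Probability.

Section Groups.
Variable R : realType.

Definition omega (d : nat) : R[i] :=
  cos (2 * pi / d%:R) +i* sin (2 * pi / d%:R).

Definition Mmx (d : nat) : 'M[R[i]]_d := diag_mx (\row_(j < d) omega d ^+ j).

Definition is_roots_of_unity_group (r d : nat) (B : {fset 'M[R[i]]_d}) :=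
  d = 1%N /\
  forall A, A \in B <-> exists2 z : R[i], z ^+ r = 1 & A = z%:M.

Definition is_signed_power_group (d : nat) (B : {fset 'M[R[i]]_d}) :=
  forall A, A \in B <->
    exists2 j : nat, (j < d)%N & A = Mmx d ^+ j \/ A = - (Mmx d ^+ j).

Definition admissible_group (d : nat) (B : {fset 'M[R[i]]_d}) :=
  (exists2 r : nat, (2 <= r)%N & is_roots_of_unity_group r B) \/
  ((2 <= d)%N /\ is_signed_power_group B).

End Groups.

Section Estimator.
Variables (R : realType) (t k : nat) (h : rel 'I_t).
Variables (a : slot k -> 'I_t) (iota : 'I_t -> slot k).
Variables (V : finType) (g : rel V) (d nc : nat).
Variable FX : free_slot a iota -> hash_family V 'M[R[i]]_d.
Variable FC : hash_family V 'I_nc.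

(* The hash functions at the free slots and the coloring are drawn           *)
(* independently: one point of the product of all seed types.                *)
Definition sample : finType :=
  ({dffun forall i : free_slot a iota, seed (FX i)} * seed FC)%type.

Variable w : sample.

Definition coloring (v : V) : 'I_nc := hash w.2 v.

(* Junk value at the distinguished slots, where it is not used. *)
Definition free_hash (i : slot k) (v : V) : 'M[R[i]]_d :=
  if insub i is Some j then hash (w.1 (j : free_slot a iota)) v else 1%:M.

Definition hashX (i : slot k) (v : V) : 'M[R[i]]_d :=
  if i == iota (a i)
  then \prod_(j in Gamma a (a i) | j != i) invmx (free_hash j v)
  else free_hash i v.

Definition edge_hash (i : 'I_k) (p : V * V) : 'M[R[i]]_d :=
  hashX (i, false) p.1 *m hashX (i, true) p.2.

Definition Zsum (i : 'I_k) (c1 c2 : 'I_nc) : 'M[R[i]]_d :=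
  \sum_(p in directed_edges g | (coloring p.1 == c1) && (coloring p.2 == c2))
    edge_hash i p.

Definition Scol (c : {ffun 'I_t -> 'I_nc}) : 'M[R[i]]_d :=
  \prod_(i < k) Zsum i (c (a (i, false))) (c (a (i, true))).

Definition Ssum : 'M[R[i]]_d :=
  \sum_(c : {ffun 'I_t -> 'I_nc} | injectiveb c) Scol c.

Definition estimator : R[i] :=
  (nc ^ t)%:R / (nc ^_ t)%:R * (\tr Ssum / (d * auto_count h)%:R).

End Estimator.

(* Main.v *)
Require Import Defs.
From mathcomp Require Import all_boot all_order all_algebra.
From mathcomp Require Import finmap.
From mathcomp Require Import reals exp trigo.
From mathcomp Require Import ring lra zify.
Import Order.TTheory GRing.Theory Num.Theory.
Local Open Scope ring_scope.
Local Open Scope complex_scope.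

Set Implicit Arguments.
Unset Strict Implicit.
Unset Printing Implicit Defensive.

(* The variance is at most the second moment. Expanding [tr S] over k-tuples  *)
(* of directed edges of G, the second moment is a sum over pairs of tuples,   *)
(* i.e. over maps w : slot * {0,1} -> V(G). A term survives the expectation   *)
(* over the hash functions only if, at each free slot j, the four vertices    *)
(* w(j,0), w(iota,0), w(j,1), w(iota,1) are equal in pairs. Call a vertex b   *)
(* of H pure if w(.,0) and w(.,1) are both constant on Gamma(b).              *)
(*   If all b are pure, w is a pair of homomorphisms H -> G, injective        *)
(* because the colors are distinct: these terms give O((#H)^2). Otherwise at  *)
(* most d of the d^2 products of diagonal entries have nonzero expectation,   *)
(* whence the 1/d. Let F be the subgraph of G covered by w, with u vertices   *)
(* and f components, and let n be the number of pure b. The maps with the     *)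
(* same coincidences as w number at most m^f D^(u-2f) where                   *)
(* D = sqrt(m/C) >= Delta, and the colors are compatible with probability at  *)
(* most C^(t+n-u) in total. At a vertex b which is not pure the sets w(.,0)   *)
(* and w(.,1) coincide; since H is connected, each component of F therefore   *)
(* meets both copies of some such b, and the handshake lemma in each          *)
(* component gives f + n <= k, while u <= 2k. As C^3 <= m, the product of the *)
(* two bounds is at most m^k / C^(2k-t).                                      *)

(** * Counting homomorphisms and coincidence patterns *)

Lemma leq_card_imset_fiber (A B C : finType) (f : A -> B) (g : A -> C)
    (H : {set A}) (n : nat) :
    (forall a, a \in H -> #|[set f b | b in H & g b == g a]| <= n)%N ->
  (#|f @: H| <= #|g @: H| * n)%N.
Proof.
move=> fib.
have sub : f @: H \subset
    \bigcup_(y in g @: H) [set f b | b in H & g b == y].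
  apply/subsetP => _ /imsetP[a aH ->]; apply/bigcupP; exists (g a).
    exact: imset_f.
  by apply: imset_f; rewrite !inE aH /=.
apply: (leq_trans (subset_leq_card sub)).
apply: (@leq_trans (\sum_(y in g @: H) #|[set f b | b in H & g b == y]|)).
  apply: (big_ind2 (fun (X : {set B}) m => #|X| <= m)%N).
  - by rewrite cards0.
  - move=> X1 m1 X2 m2 h1 h2; apply: leq_trans (leq_add h1 h2).
    exact: leq_card_setU.
  - by [].
rewrite -sum_nat_const; apply: leq_sum => _ /imsetP[a aH ->].
exact: fib.
Qed.

Section HomCount.
Variables (A Q V : finType) (ev : A -> Q -> V) (g : rel V) (e : rel Q).
Variables (w0 : Q -> V) (H : {set A}) (R : realFieldType) (D : R).
Hypothesis ev_inj : forall a b, ev a =1 ev b -> a = b.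
Hypothesis e_sym : symmetric e.
Hypothesis e_total : forall x, exists y, e x y.
Hypothesis e_w0 : forall x y, e x y -> w0 x != w0 y.
Hypothesis H_edge : forall a x y, a \in H -> e x y -> g (ev a x) (ev a y).
Hypothesis H_ker : forall a x y, a \in H -> w0 x = w0 y -> ev a x = ev a y.
Hypothesis D_deg : (max_degree g)%:R <= D.

(** Partial maps are total functions into [option V], so that the restrictions to all sets [S] live
    in one finite type. Elements of [H] are homomorphisms whose coincidences include those of the
    template [w0]; they are counted by extending restrictions, and [rs_step] bounds the cost of one
    extension. *)
Let rs (S : {set Q}) (a : A) : {ffun Q -> option V} :=
  [ffun x => if x \in S then Some (ev a x) else None].

Let rs_at (S : {set Q}) a b x : x \in S -> rs S a = rs S b -> ev a x = ev b x.
Proof. by move=> xS /ffunP/(_ x); rewrite !ffunE xS => -[]. Qed.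

Let rs_step (S S' : {set Q}) (n : nat) :
  (forall a, a \in H -> exists (T : finType) (P : {set T})
     (F : T -> {ffun Q -> option V}), (#|P| <= n)%N /\
     forall b, b \in H -> rs S b = rs S a -> exists2 z, z \in P & rs S' b = F z) ->
  (#|rs S' @: H| <= #|rs S @: H| * n)%N.
Proof.
move=> st; apply: leq_card_imset_fiber => a aH.
have [T [P [F [Pn FP]]]] := st a aH.
apply: (leq_trans _ (leq_trans (leq_imset_card F (mem P)) Pn)).
apply: subset_leq_card; apply/subsetP => _ /imsetP[b + ->].
rewrite !inE => /andP[bH /eqP bS].
have [z zP ->] := FP b bH bS; exact: imset_f.
Qed.

(** Points of [Q] with the same image are glued, so the connectivity classes correspond to the
    components of the image graph of [w0], and counting roots counts components. *)
Definition adj_or_eq : rel Q := fun x y => e x y || (w0 x == w0 y).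
Let c := adj_or_eq.

Let c_sym : connect_sym c.
Proof.
apply: sym_connect_sym => x y; by rewrite /c /adj_or_eq e_sym (eq_sym (w0 x)).
Qed.

Let D_ge0 : 0 <= D.
Proof. exact: le_trans D_deg. Qed.

(** With f components and u values met by [S], this is the bound m^f D^(u-2f), cleared of the
    negative power of [D]. *)
Let good (S : {set Q}) := #|rs S @: H|%:R * (D ^+ 2) ^+ #|fingraph.root c @: S| <=
  #|directed_edges g|%:R ^+ #|fingraph.root c @: S| * D ^+ #|w0 @: S|.

Let good0 : good set0.
Proof.
rewrite /good !imset0 !cards0 !expr0 !mulr1.
have -> : 1 = 1%:R :> R by [].
rewrite ler_nat -(cards1 ([ffun => None] : {ffun Q -> option V})).
apply: subset_leq_card; apply/subsetP => _ /imsetP[a _ ->]; rewrite inE.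
by apply/eqP/ffunP => x; rewrite !ffunE inE.
Qed.

Let imset_in (T : finType) (f : Q -> T) x (S : {set Q}) :
  f x \in f @: S -> f @: (x |: S) = f @: S.
Proof. by move=> fx; rewrite imsetU1; apply/setUidPr; rewrite sub1set. Qed.

(** A point sharing its [w0]-value with a point of [S] is forced and changes neither f nor u. Once
    no such point is left, every outside point brings a new value: a neighbor of a point of [S]
    costs at most [D] and raises u by one. If there is no neighbor either, a whole edge is added. *)
Let good_step S : good S -> S != setT -> exists2 S', good S' & S \proper S'.
Proof.
move=> gS nT.
have [x xS] : exists x, x \notin S.
  apply/existsP; apply: contraR nT => /existsPn nx.
  by apply/eqP/setP => x; rewrite inE; have := nx x; rewrite negbK => ->.
have prop1 z : z \notin S -> S \proper z |: S.
  by move=> zS; rewrite properE subsetUr subUset sub1set (negPf zS).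
case: (pickP [pred q : Q * Q | [&& q.1 \notin S, q.2 \in S & w0 q.1 == w0 q.2]]).
  move=> [z y] /= /and3P[zS yS /eqP zy].
  exists (z |: S); last exact: prop1.
  have rt : fingraph.root c z = fingraph.root c y.
    by apply/(fingraph.rootP c_sym)/connect1; rewrite /c /adj_or_eq zy eqxx orbT.
  rewrite /good !imset_in ?rt ?zy ?imset_f //.
  apply: le_trans gS; apply: ler_wpM2r; first by rewrite !exprn_ge0.
  rewrite ler_nat -[leqRHS]muln1; apply: rs_step => a aH.
  exists unit, setT, (fun=> rs (z |: S) a); split; first by rewrite cardsT card_unit.
  move=> b bH bS; exists tt; rewrite ?inE //.
  apply/ffunP => q; rewrite !ffunE !inE; case: eqP => [->|_] /=.
    by rewrite (H_ker bH zy) (H_ker aH zy) (rs_at yS bS).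
  by case: ifP => // qS; rewrite (rs_at qS bS).
move=> noeq.
have neq z y : z \notin S -> y \in S -> w0 z != w0 y.
  by move=> zS yS; have := noeq (z, y); rewrite /= zS yS /= => ->.
have w0new z : z \notin S -> #|w0 @: (z |: S)| = #|w0 @: S|.+1.
  move=> zS; rewrite imsetU1 cardsU1 (_ : w0 z \notin _) //.
  by apply/imsetP => -[y yS /eqP]; apply/negP/neq.
case: (pickP [pred q : Q * Q | [&& q.1 \notin S, q.2 \in S & e q.1 q.2]]).
  move=> [z y] /= /and3P[zS yS ezy].
  exists (z |: S); last exact: prop1.
  have rt : fingraph.root c z = fingraph.root c y.
    by apply/(fingraph.rootP c_sym)/connect1; rewrite /c /adj_or_eq ezy.
  rewrite /good (imset_in (f := fingraph.root c)) ?rt ?imset_f // w0new // (exprS D #|_|).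
  rewrite [X in _ <= X]mulrCA.
  apply: le_trans (ler_wpM2l D_ge0 gS).
  rewrite mulrA; apply: ler_wpM2r; first by rewrite !exprn_ge0.
  apply: (@le_trans _ _ ((#|rs S @: H| * max_degree g)%N)%:R); last first.
    by rewrite natrM mulrC ler_wpM2r.
  rewrite ler_nat; apply: rs_step => a aH.
  exists V, [set v | g (ev a y) v],
    (fun v => [ffun q => if q == z then Some v else rs S a q]); split.
    exact: (leq_bigmax (ev a y)).
  move=> b bH bS; exists (ev b z).
    by rewrite inE -(rs_at yS bS); apply: H_edge => //; rewrite e_sym.
  apply/ffunP => q; rewrite !ffunE !inE; case: eqP => [->|_] //=.
  by case: ifP => // qS; rewrite (rs_at qS bS).
move=> noadj.
have [y exy] := e_total x.
have yS : y \notin S.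
  by apply/negP => yS; have := noadj (x, y); rewrite /= xS yS exy.
(* Now [S] is a union of components, so [x] and its neighbor [y] open a new one. Their edge costs m,
   and their two distinct new values contribute the [D * D] that balances the new factor [D ^+ 2] on
   the left. *)
have Scl : closed c (mem S).
  move=> p q; rewrite /c /adj_or_eq /= => /orP[epq|/eqP wpq].
    apply/idP/idP => [pS|qS].
    - apply: contraT => qS; have := noadj (q, p).
      by rewrite /= pS qS e_sym epq.
    - apply: contraT => pS; have := noadj (p, q).
      by rewrite /= pS qS epq.
  apply/idP/idP => [pS|qS].
  - by apply: contraT => qS; have := neq q p qS pS; rewrite wpq eqxx.
  - by apply: contraT => pS; have := neq p q pS qS; rewrite wpq eqxx.
have rtx : fingraph.root c x = fingraph.root c y.
  by apply/(fingraph.rootP c_sym)/connect1; rewrite /c /adj_or_eq exy.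
have yS' : fingraph.root c y \notin fingraph.root c @: S.
  apply/imsetP => -[z zS /(fingraph.rootP c_sym) cyz].
  by have := closed_connect Scl cyz; rewrite zS (negPf yS).
exists (x |: (y |: S)); last first.
  by apply: proper_sub_trans (prop1 y yS) _; apply: subsetUr.
rewrite /good (imset_in (f := fingraph.root c)) ?rtx ?imset_f ?setU11 //.
rewrite imsetU1 (cardsU1 (fingraph.root c y)) yS' add1n.
rewrite (imsetU1 w0 x) cardsU1 (_ : w0 x \notin _); last first.
  rewrite imsetU1 inE negb_or inE e_w0 //=.
  by apply/imsetP => -[z zS /eqP]; apply/negP/neq.
rewrite w0new // add1n.
set E := #|directed_edges g|%:R; set F := #|fingraph.root c @: S|; set W := #|w0 @: S|.
rewrite (exprS E F) (exprS (D ^+ 2) F) (exprS D W.+1) (exprS D W).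
set EF := E ^+ F; set DF := (D ^+ 2) ^+ F; set DW := D ^+ W.
rewrite [X in _ <= X](_ : _ = D * D * (E * (EF * DW))); last by ring.
rewrite [X in X <= _](_ : _ = D * D * (#|rs (x |: (y |: S)) @: H|%:R * DF));
  last by ring.
apply: ler_wpM2l; first by rewrite mulr_ge0.
apply: le_trans (ler_wpM2l (ler0n _ _) gS).
rewrite mulrA; apply: ler_wpM2r; first by rewrite /DF !exprn_ge0.
rewrite -natrM mulnC ler_nat; apply: rs_step => a aH.
exists (V * V)%type, (directed_edges g), (fun v => [ffun q => if q == x then Some v.1 else
  if q == y then Some v.2 else rs S a q]); split => //.
move=> b bH bS; exists (ev b x, ev b y); first by rewrite inE /= H_edge.
apply/ffunP => q; rewrite !ffunE !inE; case: eqP => [->|_] //=.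
case: eqP => [->|_] //=; by case: ifP => // qS; rewrite (rs_at qS bS).
Qed.

(* The first edge of a component can be placed in at most m ways, and every *)
(* further vertex in at most D ways.                                        *)
Lemma hom_count : #|H|%:R * (D ^+ 2) ^+ #|[set fingraph.root adj_or_eq x | x : Q]| <=
  #|directed_edges g|%:R ^+ #|[set fingraph.root adj_or_eq x | x : Q]|
  * D ^+ #|[set w0 x | x : Q]|.
Proof.
have gT : good setT.
  have [n] := ubnP (#|Q| - #|[set: Q]|)%N.
  suff : forall n S, good S -> (#|~: S| <= n)%N -> good setT.
    by move=> /(_ #|Q| set0 good0); rewrite setC0 cardsT => ->.
  elim=> [|n' IH] S gS.
    rewrite leqn0 cards_eq0 => /eqP S0; suff <- : S = setT by [].
    by rewrite -[S]setCK S0 setC0.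
  move=> Sn; have [ST|nT] := eqVneq S setT; first by rewrite -ST.
  have [S' gS' SS'] := good_step gS nT; apply: (IH S') => //.
  rewrite -ltnS; apply: leq_trans Sn; apply: proper_card.
  by rewrite properC.
have -> : #|H| = #|rs setT @: H|.
  rewrite card_imset // => a b ab; apply: ev_inj => x.
  by apply: (rs_at (S := setT)); rewrite ?inE.
have imT (T : finType) (f : Q -> T) : [set f x | x : Q] = f @: setT.
  by apply/setP => y; apply/imsetP/imsetP => -[x _ ->]; exists x.
by rewrite !imT.
Qed.

End HomCount.

Lemma set2_inj (T : finType) (x y u v : T) :
  x != y -> [set u; v] = [set x; y] -> (u = x /\ v = y) \/ (u = y /\ v = x).
Proof.
move=> nxy E.
have /set2P[xu|xv] : x \in [set u; v] by rewrite E set21.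
- have /set2P[yu|yv] : y \in [set u; v] by rewrite E set22.
    by rewrite xu yu eqxx in nxy.
  by left.
- have /set2P[yu|yv] : y \in [set u; v] by rewrite E set22.
    by right.
  by rewrite xv yv eqxx in nxy.
Qed.

Definition flip (k : nat) (j : slot k) : slot k := (j.1, ~~ j.2).

Definition pairing (V : eqType) (x1 x2 y1 y2 : V) :=
  [|| (x1 == x2) && (y1 == y2), (x1 == y1) && (x2 == y2)
    | (x1 == y2) && (x2 == y1)].

Section Handshake.
Variables (t k : nat) (h : rel 'I_t) (a : slot k -> 'I_t).
Variables (iota : 'I_t -> slot k).
Hypothesis h_simple : simple_graph h.
Hypothesis h_conn : connected_graph h.
Hypothesis h_leaf : no_leaves h.
Hypothesis a_orient : is_orientation h a.
Hypothesis iota_Gamma : forall b, iota b \in Gamma a b.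

Lemma a_iota b : a (iota b) = b.
Proof. by have := iota_Gamma b; rewrite inE => /eqP. Qed.

Lemma orient_edge i : h (a (i, false)) (a (i, true)).
Proof.
have [_ E] := a_orient; have [hs hi] := h_simple.
have : [set a (i, false); a (i, true)] \in edge_set h.
  rewrite -E; exact: (imset_f (fun i => [set a (i, false); a (i, true)])).
case/imsetP => -[x y]; rewrite inE /= => hxy.
have nxy : x != y by apply: contraTneq hxy => ->; rewrite hi.
by case/(set2_inj nxy) => -[-> ->] //; rewrite hs.
Qed.

Lemma orient_flip j : h (a j) (a (flip j)).
Proof.
case: j => i [] /=; rewrite /flip /=; last exact: orient_edge.
by have [hs _] := h_simple; rewrite hs orient_edge.
Qed.

Lemma orient_onto b b' : h b b' -> exists2 j, a j = b & a (flip j) = b'.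
Proof.
move=> hbb; have [_ E] := a_orient; have [hs hi] := h_simple.
have nbb : b != b' by apply: contraTneq hbb => ->; rewrite hi.
have : [set b; b'] \in edge_set h.
  by apply/imsetP; exists (b, b') => //; rewrite inE.
rewrite -E => /imsetP[i _ /esym/(set2_inj nbb)[] [e1 e2]].
  by exists (i, false).
by exists (i, true).
Qed.

(** The slot [iota b] gives [b] a neighbor, so its degree is not 0; it is not 1 for want of leaves.
    Each neighbor is reached from a slot at [b]. *)
Lemma card_Gamma_ge2 b : (2 <= #|Gamma a b|)%N.
Proof.
have d0 : (0 < degree h b)%N.
  apply/card_gt0P; exists (a (flip (iota b))).
  by rewrite inE -{1}(a_iota b) orient_flip.
have : (2 <= degree h b)%N by have := h_leaf b; lia.
move/leq_trans; apply.
rewrite /degree.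
apply: leq_trans (leq_imset_card (fun j => a (flip j)) (mem (Gamma a b))).
apply: subset_leq_card; apply/subsetP => b'; rewrite inE => /orient_onto[j aj <-].
by apply: imset_f; rewrite inE aj.
Qed.

Lemma sum_card_Gamma : (\sum_b #|Gamma a b| = 2 * k)%N.
Proof.
transitivity #|{: slot k}|; last by rewrite card_prod card_ord card_bool mulnC.
rewrite -sum1_card (partition_big a predT) //=.
by apply: eq_bigr => b _; rewrite -sum1_card; apply: eq_bigl => j; rewrite inE.
Qed.

Lemma leq_t_k : (t <= k)%N.
Proof.
rewrite -(leq_pmul2l (isT : (0 < 2)%N)) -sum_card_Gamma mulnC.
rewrite -{1}(card_ord t) -sum_nat_const.
by apply: leq_sum => b _; apply: card_Gamma_ge2.
Qed.

Variables (V : finType) (w : slot k * bool -> V).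

Definition pure b :=
  [forall j in Gamma a b, forall s, w (j, s) == w (iota b, s)].

Definition paired := forall j, j != iota (a j) ->
  pairing (w (j, false)) (w (iota (a j), false))
    (w (j, true)) (w (iota (a j), true)).

Hypothesis w_paired : paired.

Lemma pureP j s : pure (a j) -> w (j, s) = w (iota (a j), s).
Proof.
by move=> /forall_inP/(_ j); rewrite inE eqxx => /(_ isT)/forallP/(_ s)/eqP.
Qed.

(** If the two copies agree at [iota b], the pairing makes them agree at every slot of [b].
    Otherwise each slot of [b] shows the two values of [iota b] either straight or swapped; since
    [b] is not pure some slot is swapped, and together with [iota b] it shows each value in both
    copies. *)
Lemma notpure_swap b j s : ~~ pure b -> a j = b ->
  exists2 j', a j' = b & w (j', ~~ s) = w (j, s).
Proof.
move=> /forall_inPn[j1 j1b /forallPn[s1 ne1]] ajb.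
have pr j2 : a j2 = b -> pairing (w (j2, false)) (w (iota b, false))
    (w (j2, true)) (w (iota b, true)).
  move=> <-; have [e|/w_paired//] := eqVneq j2 (iota (a j2)).
  by rewrite -e /pairing !eqxx.
have [e|ne] := eqVneq (w (iota b, false)) (w (iota b, true)).
  exists j => //.
  suff e2 : w (j, true) = w (j, false) by case: s => /=; rewrite e2.
  have := pr j ajb; rewrite /pairing e.
  by case/or3P => /andP[/eqP e1 /eqP e2]; congruence.
move: j1b; rewrite inE => /eqP j1b.
have sw j2 : a j2 = b -> (forall s, w (j2, s) = w (iota b, s)) \/
    (forall s, w (j2, s) = w (iota b, ~~ s)).
  move=> /pr; rewrite /pairing (negPf ne) andbF /=.
  by case/orP => /andP[/eqP e1 /eqP e2]; [left|right] => -[].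
have [c1|c1] := sw j1 j1b; first by rewrite c1 eqxx in ne1.
have [cj|cj] := sw j ajb; rewrite cj.
  by exists j1 => //; rewrite c1 negbK.
by exists (iota b); rewrite ?a_iota.
Qed.

(** Each [b] contributes at most [#|Gamma a b|] values: a pure one has at most two, and at any other
    [b] the first copy already shows all of them by [notpure_swap]. *)
Lemma card_image_paired : (#|[set w x | x : slot k * bool]| <= 2 * k)%N.
Proof.
rewrite -sum_card_Gamma.
have sub : [set w x | x : slot k * bool] \subset
    \bigcup_b [set w x | x : slot k * bool & a x.1 == b].
  apply/subsetP => _ /imsetP[x _ ->]; apply/bigcupP; exists (a x.1) => //.
  by apply: imset_f; rewrite inE.
apply: (leq_trans (subset_leq_card sub)).
apply: (@leq_trans (\sum_b #|[set w x | x : slot k * bool & a x.1 == b]|)).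
  apply: (big_ind2 (fun (X : {set V}) m => #|X| <= m)%N) => //.
  - by rewrite cards0.
  - move=> X1 m1 X2 m2 h1 h2; apply: leq_trans (leq_add h1 h2).
    exact: leq_card_setU.
apply: leq_sum => b _; have [pb|npb] := boolP (pure b).
  apply: leq_trans (card_Gamma_ge2 b).
  apply: (@leq_trans #|[set w (iota b, false); w (iota b, true)]|); last first.
    by rewrite cards2; case: (_ != _).
  apply: subset_leq_card; apply/subsetP => _ /imsetP[[j s] /[!inE] /= /eqP jb ->].
  by rewrite pureP ?jb //; case: s; rewrite eqxx ?orbT.
apply: leq_trans (leq_imset_card (fun j => w (j, false)) (mem (Gamma a b))).
apply: subset_leq_card; apply/subsetP => _ /imsetP[[j s] /[!inE] /= /eqP jb ->].
case: s; last by apply: imset_f; rewrite inE jb.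
have [j' j'b <-] := notpure_swap true npb jb.
by apply: imset_f; rewrite inE j'b.
Qed.

(** This is the source graph for [hom_count]: a perfect matching of 2k separate edges, k for each
    copy. The way the edges of [h] meet enters only through coincidences of [w]. *)
Definition partner : rel (slot k * bool) :=
  fun x y => y == (flip x.1, x.2).

Lemma partner_sym : symmetric partner.
Proof.
move=> [[i e] s] [[i' e'] s']; rewrite /partner /flip /=.
by apply/eqP/eqP => -[-> -> ->]; rewrite negbK.
Qed.

Lemma partner_total x : exists y, partner x y.
Proof. by exists (flip x.1, x.2); rewrite /partner. Qed.

Let c := adj_or_eq partner w.

Let c_sym : connect_sym c.
Proof.
by apply: sym_connect_sym => x y; rewrite /c /adj_or_eq partner_sym (eq_sym (w x)).
Qed.

Let root_flip j s : fingraph.root c (flip j, s) = fingraph.root c (j, s).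
Proof.
apply/esym/(fingraph.rootP c_sym)/connect1.
by rewrite /c /adj_or_eq /partner eqxx.
Qed.

Let root_eq x y : w x = w y -> fingraph.root c x = fingraph.root c y.
Proof.
move=> e; apply/(fingraph.rootP c_sym)/connect1.
by rewrite /c /adj_or_eq e eqxx orbT.
Qed.

Let root_pure j s : pure (a j) ->
  fingraph.root c (j, s) = fingraph.root c (iota (a j), s).
Proof. by move=> /pureP e; apply: root_eq. Qed.

Hypothesis w_notpure : ~~ [forall b, pure b].

(** If every slot of copy [s0] in the component sat at a pure vertex, the set [Z] of vertices of [h]
    whose copy lies in the component would be closed under adjacency, hence everything, and all
    vertices would be pure. From a vertex that is not pure, [notpure_swap] leads to the other
    copy. *)
Let notpure_in_component j0 s0 s :
  exists2 j, ~~ pure (a j) & fingraph.root c (j, s) = fingraph.root c (j0, s0).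
Proof.
suff [j npj rj] : exists2 j, ~~ pure (a j) &
    fingraph.root c (j, s0) = fingraph.root c (j0, s0).
  have [->|ns] := eqVneq s s0; first by exists j.
  have [j' aj' e] := notpure_swap s0 npj erefl.
  exists j'; first by rewrite aj'.
  by rewrite -rj (_ : s = ~~ s0); [apply: root_eq | case: (s) (s0) ns => -[]].
have [/existsP[j /andP[npj /eqP rj]]|/existsPn none] := boolP
  [exists j, ~~ pure (a j) && (fingraph.root c (j, s0) == fingraph.root c (j0, s0))].
  by exists j.
have allp j : fingraph.root c (j, s0) = fingraph.root c (j0, s0) -> pure (a j).
  by move=> rj; have := none j; rewrite rj eqxx andbT negbK.
pose Z := [pred b | fingraph.root c (iota b, s0) == fingraph.root c (j0, s0)].
have Zin j : fingraph.root c (j, s0) = fingraph.root c (j0, s0) -> a j \in Z.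
  by move=> rj; rewrite inE -root_pure ?rj //; apply: allp.
have Zcl b b' : h b b' -> b \in Z -> b' \in Z.
  move=> /orient_onto[j <- <-] /eqP bZ; apply: Zin; rewrite root_flip -bZ.
  by apply: root_pure; rewrite -(a_iota (a j)); apply: allp.
have hcl : closed h Z.
  move=> b b' hbb; apply/idP/idP; first exact: Zcl.
  by apply: Zcl; have [hs _] := h_simple; rewrite hs.
have /forallPn[b npb] := w_notpure.
have bZ : b \in Z.
  by rewrite -(closed_connect hcl (h_conn.2 (a j0) b)); apply: Zin.
by exists (iota b); [rewrite a_iota | apply/eqP].
Qed.

Let roots := [set fingraph.root c x | x : slot k * bool].
Let ne r s := #|[set i : 'I_k | fingraph.root c ((i, false), s) == r]|.
Let np r s := #|[set b | pure b & fingraph.root c (iota b, s) == r]|.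

(* Handshake inside a component: its slots on side [s] number [2 * ne r s], *)
(* each pure vertex accounts for at least two of them, and at least one slot *)
(* is left over; parity then gains a whole edge.                             *)
Let np_lt_ne r s : r \in roots -> (np r s < ne r s)%N.
Proof.
case/imsetP => -[j0 s0] _ def_r.
have [j1 npj1 rj1] := notpure_in_component j0 s0 s.
rewrite -def_r in rj1.
pose K := [set j : slot k | fingraph.root c (j, s) == r].
have K1 : #|K| = (2 * ne r s)%N.
  rewrite -sum1_card (reindex (fun p : 'I_k * bool => (p.1, p.2))) /=; last first.
    by exists id => -[].
  rewrite -(pair_big_dep predT (fun i e => (i, e) \in K) (fun _ _ => 1%N)) /=.
  rewrite /ne -sum1_card big_distrr /= [RHS]big_mkcond /=.
  apply: eq_bigr => i _; rewrite big_mkcond big_bool /= !inE.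
  by rewrite -(root_flip (i, false)) /flip /=; case: (_ == _).
suff : (2 * np r s + 1 <= #|K|)%N by rewrite K1; lia.
have -> : #|K| = (\sum_b #|K :&: Gamma a b|)%N.
  rewrite -sum1_card (partition_big a predT) //=.
  apply: eq_bigr => b _; rewrite -sum1_card.
  by apply: eq_bigl => j; rewrite !inE.
have -> : (2 * np r s + 1 = \sum_b (2 * (pure b && (fingraph.root c (iota b, s) == r))
    + (b == a j1)))%N.
  rewrite big_split /= -big_distrr /=; congr (2 * _ + _)%N.
    rewrite /np -sum1_card big_mkcond; apply: eq_bigr => b _.
    by rewrite inE; case: (_ && _).
  by rewrite (bigD1 (a j1)) //= eqxx big1 // => b /negPf ->.
apply: leq_sum => b _; have [pb|npb] /= := boolP (pure b).
  have -> : (b == a j1) = false.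
    by apply: contraNF npj1 => /eqP <-.
  case: eqP => //= rb; rewrite addn0 muln1; apply: leq_trans (card_Gamma_ge2 b) _.
  apply: subset_leq_card; apply/subsetP => j; rewrite !inE => /eqP jb.
  by rewrite root_pure ?jb // rb !eqxx.
case: eqP => // ->; rewrite muln0; apply/card_gt0P.
by exists j1; rewrite !inE rj1 !eqxx.
Qed.

(** Every component meets the [true] copy, so that copy alone suffices: [np_lt_ne] gains one edge
    per component, and summing over the components gives k edges against the pure vertices plus the
    components. *)
Lemma components_add_pure :
  (#|[set fingraph.root c x | x : slot k * bool]| + #|[set b | pure b]| <= k)%N.
Proof.
rewrite -/roots.
have Sne s : (\sum_(r in roots) ne r s = k)%N.
  rewrite -[RHS]card_ord -sum1_card.
  rewrite (partition_big (fun i => fingraph.root c ((i, false), s)) (mem roots)).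
    by apply: eq_bigr => r _; rewrite /ne -sum1_card; apply: eq_bigl => i; rewrite !inE.
  by move=> i _; apply: imset_f.
have Snp s : (\sum_(r in roots) np r s = #|[set b | pure b]|)%N.
  rewrite -sum1_card.
  rewrite (partition_big (fun b => fingraph.root c (iota b, s)) (mem roots)).
    by apply: eq_bigr => r _; rewrite /np -sum1_card; apply: eq_bigl => b; rewrite !inE.
  by move=> b _; apply: imset_f.
apply: leq_trans (eq_leq (Sne true)).
rewrite -{1}sum1_card -(Snp true) -big_split /=.
by apply: leq_sum => r rr; rewrite add1n; apply: np_lt_ne.
Qed.

End Handshake.

(** * The matrix groups *)

Section Roots.
Variable R : realType.
Implicit Types (x : R) (d n : nat).

Lemma cos_sin_expr x n :
  (cos x +i* sin x) ^+ n = cos (x *+ n) +i* sin (x *+ n).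
Proof.
elim: n => [|n IH]; first by rewrite expr0 mulr0n cos0 sin0.
rewrite exprS IH mulrS cosD sinD; apply/eqP; rewrite eq_complex /=.
by apply/andP; split; apply/eqP; ring.
Qed.

Lemma omega_prim_root d : (0 < d)%N -> d.-primitive_root (omega R d).
Proof.
move=> d0; rewrite /primitive_root_of_unity d0 /=.
have dR : 0 < d%:R :> R by rewrite ltr0n.
apply/forallP => i; rewrite unity_rootE /omega cos_sin_expr.
(* The angle is written as 2y because, for 0 < y < pi, the real part cos 2y = cos^2 y - sin^2 y is
   then visibly different from 1. *)
have -> : (2 * pi / d%:R *+ i.+1 : R) = pi * (i.+1%:R / d%:R) *+ 2.
  by rewrite -mulr_natr; ring.
apply/eqP; have [->|ne] := eqVneq i.+1 d.
  by rewrite divff ?(gt_eqF dR) // mulr1 cos2pi sin2pi eqxx.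
have lt_id : (i.+1 < d)%N by have := ltn_ord i; lia.
set y := pi * _; have y0 : 0 < y < pi.
  rewrite /y mulr_gt0 ?pi_gt0 ?divr_gt0 ?ltr0n //=.
  by rewrite gtr_pMr ?pi_gt0 // ltr_pdivrMr // mul1r ltr_nat.
have := sin_gt0_pi y0; have := cos2Dsin2 y => e s0.
apply/negbTE; rewrite eq_complex /= cos_mulr2n negb_and; apply/orP; left.
have : 0 < sin y ^+ 2 by rewrite exprn_gt0.
by apply: contraTneq => e2; rewrite -leNgt; lra.
Qed.

Lemma omega_expr_inj d (p q : 'I_d) : omega R d ^+ p = omega R d ^+ q -> p = q.
Proof.
have d0 : (0 < d)%N by apply: leq_ltn_trans (ltn_ord p).
move/eqP; rewrite (eq_prim_root_expr (omega_prim_root d0)) !modn_small //.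
by move/eqP/ord_inj.
Qed.

Lemma norm_omega d : `|omega R d| = 1.
Proof. by rewrite normc_def /= cos2Dsin2 sqrtr1. Qed.

End Roots.

Definition diagonal (R : nzRingType) d (A : 'M[R]_d) :=
  forall i j, i != j -> A i j = 0.

Section Diagonal.
Variables (R : comUnitRingType) (d : nat).
Implicit Types A B : 'M[R]_d.

Lemma diagonal_mxE A B i j : diagonal A -> (A *m B) i j = A i i * B i j.
Proof.
move=> dA; rewrite mxE (bigD1 i) //= big1 ?addr0 // => l li.
by rewrite dA ?mul0r // eq_sym.
Qed.

Lemma diagonal_mulmx A B : diagonal A -> diagonal B -> diagonal (A *m B).
Proof. by move=> dA dB i j ij; rewrite diagonal_mxE // dB ?mulr0. Qed.

Lemma diagonal1 : diagonal (1%:M : 'M[R]_d).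
Proof. by move=> i j ij; rewrite mxE (negPf ij). Qed.

Lemma diagonal_prod I (s : seq I) (P : pred I) (F : I -> 'M[R]_d) :
  (forall i, P i -> diagonal (F i)) -> diagonal (\prod_(i <- s | P i) F i).
Proof.
move=> dF; apply: (big_ind (@diagonal R d)) => //; first exact: diagonal1.
by move=> A B; apply: diagonal_mulmx.
Qed.

Lemma diagonal_prodE I (s : seq I) (P : pred I) (F : I -> 'M[R]_d) p :
  (forall i, P i -> diagonal (F i)) ->
  (\prod_(i <- s | P i) F i) p p = \prod_(i <- s | P i) F i p p.
Proof.
move=> dF; suff [] : diagonal (\prod_(i <- s | P i) F i) /\
  (\prod_(i <- s | P i) F i) p p = \prod_(i <- s | P i) F i p p by [].
apply: (big_rec2 (fun (A : 'M[R]_d) z => diagonal A /\ A p p = z)).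
  by split; [exact: diagonal1 | rewrite mxE eqxx].
move=> i z A Pi [dA <-]; split; first by apply: diagonal_mulmx => //; apply: dF.
by rewrite diagonal_mxE //; apply: dF.
Qed.

Lemma diagonal_sum I (s : seq I) (P : pred I) (F : I -> 'M[R]_d) :
  (forall i, P i -> diagonal (F i)) -> diagonal (\sum_(i <- s | P i) F i).
Proof.
move=> dF; apply: (big_ind (@diagonal R d)) => //; first by move=> i j _; rewrite mxE.
by move=> A B dA dB i j ij; rewrite mxE dA ?dB ?addr0.
Qed.

Lemma diagonal_invmx A :
  diagonal A -> (forall p, A p p \is a GRing.unit) ->
  diagonal (invmx A) /\ forall p, invmx A p p = (A p p)^-1.
Proof.
move=> dA uA; pose A' := diag_mx (\row_p (A p p)^-1).
have dA' : diagonal A' by move=> i j ij; rewrite !mxE (negPf ij) mulr0n.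
have AA' : A *m A' = 1%:M.
  apply/matrixP => i j; rewrite diagonal_mxE // !mxE.
  by case: eqP => [->|_]; rewrite ?mulr0n ?mulr1n ?mulr0 // mulrV.
have [uAm _] := mulmx1_unit AA'.
have -> : invmx A = A'.
  by rewrite -[RHS]mul1mx -(mulVmx uAm) -mulmxA AA' mulmx1.
by split=> // p; rewrite !mxE eqxx mulr1n.
Qed.

End Diagonal.

Section CharacterSums.
Variables (R : realType) (d : nat).
Local Notation C := R[i].

(* [A p p], for [p < d], are the characters of a group [B] of unitary diagonal *)
(* matrices. The sums say that they are not trivial, that they are pairwise    *)
(* distinct, and that each is inverse to at most one of them.                  *)
Record character_group (B : {fset 'M[C]_d}) : Prop := CharacterGroup {
  cg_dim : (0 < d)%N;
  cg_ex : exists A, A \in B;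
  cg_diag : forall A, A \in B -> diagonal A;
  cg_norm : forall A p, A \in B -> `|A p p| = 1;
  cg_sum : forall p, \sum_(A <- B) A p p = 0;
  cg_sumV : forall p q q', \sum_(A <- B) A p p / A q q != 0 ->
     \sum_(A <- B) A p p / A q' q' != 0 -> q = q';
  cg_sumM : forall p q q', \sum_(A <- B) A p p * A q q != 0 ->
     \sum_(A <- B) A p p * A q' q' != 0 -> q = q' }.

(** Translation by [A0] permutes [B] and multiplies the sum by [z]. *)
Lemma character_sum0 (B : {fset 'M[C]_d}) (A0 : 'M[C]_d) (chi : 'M[C]_d -> C) z :
  A0 \in unitmx -> (forall A, A \in B -> A0 *m A \in B) ->
  (forall A, A \in B -> chi (A0 *m A) = z * chi A) -> z != 1 ->
  \sum_(A <- B) chi A = 0.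
Proof.
move=> uA0 clB chiM z1.
have pm : perm_eq [seq A0 *m A | A <- B] B.
  have us : uniq [seq A0 *m A | A <- B].
    rewrite map_inj_uniq ?fset_uniq // => X Y XY.
    by rewrite -[X](mulKmx uA0) XY mulKmx.
  apply: uniq_perm => //; first exact: fset_uniq.
  have ss : {subset [seq A0 *m A | A <- B] <= B}.
    by move=> _ /mapP[X XB ->]; apply: clB.
  have sz : (size B <= size [seq A0 *m A | A <- B])%N by rewrite size_map.
  exact: (uniq_min_size us ss sz).2.
have e : \sum_(A <- B) chi A = z * \sum_(A <- B) chi A.
  rewrite -{1}(perm_big _ pm) big_map mulr_sumr /= big_seq [RHS]big_seq.
  by apply: eq_bigr => A AB; apply: chiM.
apply/eqP; have : (1 - z) * \sum_(A <- B) chi A = 0 by rewrite mulrBl mul1r -e subrr.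
by move/eqP; rewrite mulf_eq0 subr_eq0 eq_sym (negPf z1).
Qed.

Lemma roots_of_unity_character_group r (B : {fset 'M[C]_d}) : (2 <= r)%N ->
  is_roots_of_unity_group r B -> character_group B.
Proof.
move=> r2 [d1 memB].
have r0 : (0 < r)%N by apply: ltnW.
have pr := @omega_prim_root R r r0.
have dI (p q : 'I_d) : p = q.
  by apply: ord_inj; have := ltn_ord p; have := ltn_ord q; lia.
split.
- by rewrite d1.
- by exists 1%:M; apply/memB; exists 1; rewrite ?expr1n.
- by move=> A _ i j; rewrite (dI i j) eqxx.
- move=> _ p /memB[z zr ->]; rewrite mxE eqxx mulr1n; apply/eqP.
  by rewrite -(@pexpr_eq1 _ _ r) ?normr_ge0 // -normrX zr normr1.
- move=> p; apply: (@character_sum0 _ (omega R r)%:M _ (omega R r)).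
  + rewrite unitmxE det_scalar unitfE expf_eq0 negb_and; apply/orP; right.
    by rewrite (prim_root_eq0 pr) -lt0n.
  + move=> _ /memB[z zr ->]; apply/memB; exists (omega R r * z).
      by rewrite exprMn zr (prim_expr_order pr) mulr1.
    by rewrite scalar_mxM.
  + by move=> A _; rewrite mul_scalar_mx mxE.
  + rewrite -[_ r]expr1 -(expr0 (omega R r)) (eq_prim_root_expr pr).
    by rewrite mod0n modn_small.
- by move=> p q q' _ _; apply: dI.
- by move=> p q q' _ _; apply: dI.
Qed.

Lemma Mmx_expr j : Mmx R d ^+ j = diag_mx (\row_(p < d) omega R d ^+ (p * j)).
Proof.
elim: j => [|j IH].
  rewrite expr0; apply/matrixP => p q; rewrite !mxE muln0 expr0.
  by case: eqP.
rewrite exprS IH -mulmxE mulmx_diag; congr diag_mx.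
by apply/rowP => p; rewrite !mxE -exprD mulnS.
Qed.

(** The signs serve [cg_sum]: the entry 0 of every power of M is 1, so translation by -I is used
    there. For the other two sums translation by M multiplies by omega^(p-q) or omega^(p+q), and
    primitivity of omega leaves at most one [q] for each [p]. *)
Lemma signed_power_character_group (B : {fset 'M[C]_d}) : (2 <= d)%N ->
  is_signed_power_group B -> character_group B.
Proof.
move=> d2 memB.
have d0 : (0 < d)%N by apply: ltnW.
have pr := @omega_prim_root R d d0.
have Mdiag j : diagonal (Mmx R d ^+ j).
  by move=> p q pq; rewrite Mmx_expr !mxE (negPf pq) mulr0n.
have Mpp j p : (Mmx R d ^+ j) p p = omega R d ^+ (p * j).
  by rewrite Mmx_expr !mxE eqxx mulr1n.
have Bform A : A \in B -> exists j (b : bool), (j < d)%N /\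
    A = (-1) ^+ b *: Mmx R d ^+ j.
  move=> /memB[j jd [->|->]]; first by exists j, false; rewrite expr0 scale1r.
  by exists j, true; rewrite expr1 scaleN1r.
have Bin j (b : bool) : (-1) ^+ b *: Mmx R d ^+ j \in B.
  have Md : Mmx R d ^+ d = 1.
    rewrite Mmx_expr; apply/matrixP => p q; rewrite !mxE mulnC exprM.
    by rewrite (prim_expr_order pr) expr1n; case: eqP.
  rewrite (divn_eq j d) exprD mulnC exprM Md expr1n mul1r; apply/memB.
  exists (j %% d)%N; first by rewrite ltn_mod.
  by case: b; rewrite ?expr1 ?expr0 ?scaleN1r ?scale1r; [right|left].
have Bdiag A : A \in B -> diagonal A.
  by move=> /Bform[j [b [_ ->]]] p q pq; rewrite mxE Mdiag // mulr0.
have Bnorm A p : A \in B -> `|A p p| = 1.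
  move=> /Bform[j [b [_ ->]]]; rewrite mxE Mpp normrM !normrX normrN1 norm_omega.
  by rewrite !expr1n mulr1.
have clM A : A \in B -> Mmx R d *m A \in B.
  by move=> /Bform[j [b [_ ->]]]; rewrite -scalemxAr mulmxE -exprS Bin.
have uM : Mmx R d \in unitmx.
  rewrite -[Mmx R d]expr1 Mmx_expr unitmxE det_diag unitrE.
  rewrite -unitrE unitfE; apply/prodf_neq0 => p _.
  by rewrite mxE expf_eq0 (prim_root_eq0 pr) (gtn_eqF d0) andbF.
have M1pp p A : (Mmx R d *m A) p p = omega R d ^+ p * A p p.
  rewrite diagonal_mxE; first by have := Mpp 1%N p; rewrite expr1 muln1 => ->.
  by have := Mdiag 1%N; rewrite expr1.
have om_neq0 p : omega R d ^+ p != 0.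
  by rewrite expf_eq0 (prim_root_eq0 pr) (gtn_eqF d0) andbF.
split=> //.
- by exists 1%:M; have := Bin 0%N false; rewrite scale1r expr0.
- move=> p; apply: (@character_sum0 _ (-1)%:M _ (-1)).
  + by rewrite unitmxE det_scalar unitfE expf_eq0 oppr_eq0 oner_eq0 andbF.
  + move=> _ /Bform[j [b [_ ->]]]; rewrite mul_scalar_mx scalerA.
    by rewrite -[X in X * _]expr1 -exprD -signr_odd Bin.
  + by move=> A _; rewrite mul_scalar_mx mxE.
  + by rewrite lt_eqF // (lt_trans _ ltr01) // oppr_lt0 ltr01.
- have sV p q : \sum_(A <- B) A p p / A q q != 0 -> p = q.
    move=> ne; apply: (@omega_expr_inj R d); apply/eqP; apply: contraNT ne => npq.
    apply/eqP; apply: (@character_sum0 _ _ _ (omega R d ^+ p / omega R d ^+ q)) uM clM _ _.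
      move=> A AB; rewrite !M1pp invfM; ring.
    by apply: contraNneq npq => e; rewrite -[X in X == _](divfK (om_neq0 q)) e mul1r.
  by move=> p q q' /sV <- /sV <-.
- have sM p q : \sum_(A <- B) A p p * A q q != 0 -> omega R d ^+ p * omega R d ^+ q = 1.
    move=> ne; apply/eqP; apply: contraNT ne => npq.
    apply/eqP; apply: (@character_sum0 _ _ _ (omega R d ^+ p * omega R d ^+ q)) uM clM _ npq.
    move=> A AB; rewrite !M1pp; ring.
  move=> p q q' /sM e1 /sM e2; apply: (@omega_expr_inj R d).
  by apply: (mulfI (om_neq0 p)); rewrite e1 e2.
Qed.

Lemma admissible_character_group (B : {fset 'M[C]_d}) :
  admissible_group B -> character_group B.
Proof.
case=> [[r r2]|[d2]]; first exact: roots_of_unity_character_group.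
exact: signed_power_character_group.
Qed.

End CharacterSums.

(** * Expectations over hash families *)

Section Expectation.
Variable R : realType.
Local Notation C := R[i].

Lemma Pr_complex (Om : finType) (E : pred Om) :
  (Pr R E)%:C = expectation (fun s => (E s)%:R : C).
Proof.
rewrite /Pr /expectation rmorphM fmorphV /= !rmorph_nat; congr (_ / _).
rewrite -sum1_card natr_sum big_mkcond /=; apply: eq_bigr => s _.
by rewrite unfold_in; case: (E s).
Qed.

Lemma expectation_eq (Om : finType) (X Y : Om -> C) :
  X =1 Y -> expectation X = expectation Y.
Proof. by move=> XY; rewrite /expectation; under eq_bigr do rewrite XY. Qed.

Lemma expectation_sum (Om I : finType) (P : pred I) (X : I -> Om -> C) :
  expectation (fun w => \sum_(i | P i) X i w) = \sum_(i | P i) expectation (X i).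
Proof. by rewrite /expectation exchange_big mulr_suml. Qed.

Lemma expectationZ (Om : finType) (z : C) (X : Om -> C) :
  expectation (fun w => z * X w) = z * expectation X.
Proof. by rewrite /expectation -mulr_sumr mulrA. Qed.

Lemma le_expectation (Om : finType) (X Y : Om -> C) :
  (forall w, X w <= Y w) -> expectation X <= expectation Y.
Proof.
by move=> XY; rewrite ler_wpM2r ?invr_ge0 ?ler0n //; apply: ler_sum.
Qed.

Lemma norm_expectation_le1 (Om : finType) (X : Om -> C) :
  (forall w, `|X w| <= 1) -> `|expectation X| <= 1.
Proof.
move=> X1; rewrite normrM normfV normr_nat.
have [->|n0] := eqVneq #|Om| 0%N; first by rewrite invr0 mulr0 ler01.
rewrite ler_pdivrMr ?ltr0n ?lt0n // mul1r.
apply: le_trans (ler_norm_sum _ _ _) _.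
by apply: le_trans (ler_sum _ (fun w _ => X1 w)) _; rewrite sumr_const.
Qed.

Lemma variance_le (Om : finType) (X : Om -> C) :
  (0 < #|Om|)%N -> variance X <= expectation (fun w => `|X w| ^+ 2).
Proof.
move=> n0; rewrite /variance; set mu := expectation X.
have nC : #|Om|%:R != 0 :> C by rewrite pnatr_eq0 -lt0n.
have Econst (z : C) : expectation (fun _ : Om => z) = z.
  by rewrite /expectation sumr_const -[X in X / _]mulr_natr (mulfK nC).
have -> : expectation (fun w => `|X w - mu| ^+ 2) =
    expectation (fun w => `|X w| ^+ 2) - `|mu| ^+ 2.
  transitivity (expectation (fun w => `|X w| ^+ 2) +
     expectation (fun w => (- mu^*)%R * X w) + expectation (fun w => (- mu) * (X w)^*%R)
     + expectation (fun _ : Om => `|mu| ^+ 2)).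
    rewrite /expectation -!mulrDl -!big_split /=; congr (_ / _).
    by apply: eq_bigr => w _; rewrite !normCK rmorphB /=; ring.
  have -> : expectation (fun w => - mu * (X w)^*%R) = - mu * mu^*%R.
    rewrite expectationZ; congr (_ * _).
    by rewrite /mu /expectation rmorphM rmorph_sum fmorphV /= rmorph_nat.
  by rewrite expectationZ Econst -/mu normCK; ring.
by rewrite lerBlDr lerDl exprn_ge0.
Qed.

Lemma expectation_pair (O1 O2 : finType) (X : O1 -> C) (Y : O2 -> C) :
  expectation (fun w : O1 * O2 => X w.1 * Y w.2) = expectation X * expectation Y.
Proof.
rewrite /expectation card_prod natrM invfM mulrACA; congr (_ * _).
rewrite mulr_suml -(pair_bigA _ (fun x y => X x * Y y)) /=.
by apply: eq_bigr => x _; rewrite mulr_sumr.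
Qed.

Lemma sum_dffun (I : finType) (T_ : I -> finType) (P : forall i, T_ i -> C) :
  \sum_(f : {dffun forall i : I, T_ i}) \prod_i P i (f i)
  = \prod_i \sum_(x : T_ i) P i x.
Proof.
rewrite (reindex (@dffun_of_fprod I T_)); last exact/onW_bij/dffun_of_fprod_bij.
pose P' i := [ffun x : T_ i => P i x].
transitivity (\sum_(t : fprod T_) \prod_(i in I) P' i (t i)).
  by apply: eq_bigr => f _; apply: eq_bigr => i _; rewrite !ffunE.
rewrite (big_fprod _ _ P') /=.
rewrite -(bigA_distr_big_dep (fun i => tagged_with T_ i)
  (fun i x => untag 0 (P' i) x)).
apply: eq_bigr => i _; rewrite -(big_tag (fun i (x : T_ i) => P' i x)).
by apply: eq_bigr => x _; rewrite ffunE.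
Qed.

Lemma expectation_dffun (I : finType) (T_ : I -> finType)
    (P : forall i, T_ i -> C) :
  expectation (fun f : {dffun forall i : I, T_ i} => \prod_i P i (f i))
  = \prod_i expectation (P i).
Proof.
rewrite /expectation sum_dffun big_split /= prodfV; congr (_ / _).
have /= := sum_dffun (fun i (_ : T_ i) => 1 : C).
under eq_bigr do rewrite big1_eq.
rewrite sumr_const => ->; apply: eq_bigr => i _; by rewrite sumr_const.
Qed.

End Expectation.

Section HashFamilies.
Variables (R : realType) (V : finType) (A : choiceType) (B : {fset A}).
Variables (F : hash_family V A) (n : nat).
Local Notation C := R[i].
Hypothesis B_ex : exists x, x \in B.
Hypothesis F_unif : uniform_on R B F.
Hypothesis F_kwise : kwise_independent R n F.

Let B_neq0 : #|` B|%:R != 0 :> R.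
Proof.
have [x xB] := B_ex; rewrite pnatr_eq0 cardfs_eq0.
by apply: contraTneq xB => ->; rewrite inE.
Qed.

Lemma seed_gt0 (v : V) : (0 < #|seed F|)%N.
Proof.
have [x xB] := B_ex; have := F_unif v xB; rewrite /Pr lt0n.
apply: contra_eqN => /eqP ->; rewrite invr0 mulr0 eq_sym invr_eq0.
exact: B_neq0.
Qed.

(** [uniform_on] only prescribes the probabilities of values in [B]; they already sum to 1, so no
    seed is left for a value outside [B]. *)
Lemma hash_in (v : V) (s : seed F) : hash s v \in B.
Proof.
have s0 := seed_gt0 v.
have sR : #|seed F|%:R != 0 :> R by rewrite pnatr_eq0 -lt0n.
have e : (\sum_(x <- B) #|[pred s : seed F | hash s v == x]| = #|seed F|)%N.
  apply/eqP; rewrite -(eqr_nat R) natr_sum.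
  apply/eqP; transitivity (\sum_(x <- B) #|seed F|%:R / #|` B|%:R : R).
    rewrite big_seq [RHS]big_seq; apply: eq_bigr => x xB.
    by rewrite -(F_unif v xB) /Pr mulrCA mulfV ?mulr1.
  by rewrite big_const_seq count_predT iter_addr_0 -[LHS]mulr_natr (divfK B_neq0).
have e2 : (\sum_(x <- B) #|[pred s : seed F | hash s v == x]| =
    #|[pred s : seed F | hash s v \in B]|)%N.
  under eq_bigr do rewrite -sum1_card big_mkcond.
  rewrite exchange_big /= -sum1_card [RHS]big_mkcond; apply: eq_bigr => s' _ /=.
  rewrite -big_mkcond /= sum1_count (@eq_count _ _ (pred1 (hash s' v))); last first.
    by move=> x; rewrite /= eq_sym.
  by rewrite (count_uniq_mem _ (fset_uniq B)) inE; case: (_ \in _).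
have : [pred s : seed F | hash s v \in B] =i predT.
  by apply/subset_cardP; [rewrite -e2 e | apply/subsetP].
by move/(_ s); rewrite !inE.
Qed.

Lemma expectation_hash (v : V) (f : A -> C) :
  expectation (fun s : seed F => f (hash s v)) = (\sum_(x <- B) f x) / #|` B|%:R.
Proof.
transitivity (\sum_(x <- B) (Pr R [pred s : seed F | hash s v == x])%:C * f x).
  under [RHS]eq_bigr do rewrite Pr_complex mulrC /expectation mulrA mulr_sumr.
  rewrite -mulr_suml exchange_big /=; congr (_ / _); apply: eq_bigr => s _.
  rewrite (bigD1_seq (hash s v)) ?hash_in ?fset_uniq //= eqxx mulr1.
  by rewrite big1 ?addr0 // => x /negPf nx; rewrite eq_sym nx mulr0.
rewrite mulr_suml big_seq [RHS]big_seq; apply: eq_bigr => x xB.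
by rewrite (F_unif v xB) fmorphV /= rmorph_nat mulrC.
Qed.

(** Independence is stated for events, so each factor is expanded into indicators of the values in
    [B] and the product of sums is distributed. *)
Lemma expectation_prod (D : {set V}) (f : V -> A -> C) : (#|D| <= n)%N ->
  expectation (fun s : seed F => \prod_(v in D) f v (hash s v))
  = \prod_(v in D) expectation (fun s : seed F => f v (hash s v)).
Proof.
move=> Dn; have [b0 b0B] := B_ex; pose j0 : B := [` b0B]%fset.
have fE (s : seed F) v : f v (hash s v) = \sum_(x : B) (hash s v == val x)%:R * f v (val x).
  rewrite (bigD1 [` hash_in v s]%fset) //= eqxx mul1r big1 ?addr0 // => x nx.
  case: eqP => [e|]; rewrite ?mul0r //; case/eqP: nx; exact: val_inj.
under expectation_eq => s do under eq_bigr => v _ do rewrite fE.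
under expectation_eq => s do rewrite (big_distr_big j0) /=.
rewrite expectation_sum.
under [RHS]eq_bigr => v _ do under expectation_eq => s do rewrite fE.
under [RHS]eq_bigr => v _ do rewrite expectation_sum.
rewrite (big_distr_big j0) /=; apply: eq_bigr => y _.
under expectation_eq => s do rewrite big_split /= mulrC.
rewrite expectationZ.
transitivity (\prod_(v in D) (f v (val (y v)) *
    (Pr R [pred s : seed F | hash s v == val (y v)])%:C)).
  rewrite big_split /=; congr (_ * _).
  rewrite -rmorph_prod -(F_kwise (fun v => val (y v)) Dn) /= Pr_complex.
  apply: expectation_eq => s; rewrite /=.
  case: forall_inP => [yes|no].
    by apply: big1 => v vD; rewrite yes.
  have /forall_inPn[v vD nv] : ~~ [forall v in D, hash s v == val (y v)].
    by apply/negP => /forall_inP.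
  by apply/eqP/prodf_eq0; exists v; rewrite // (negPf nv).
apply: eq_bigr => v _; rewrite Pr_complex -expectationZ; apply: expectation_eq => s.
by rewrite mulrC.
Qed.

Lemma expectation_tuple (I : finType) (u : I -> V) (f : I -> A -> C) :
    (#|I| <= n)%N ->
  expectation (fun s : seed F => \prod_i f i (hash s (u i)))
  = \prod_(v in u @: I) ((\sum_(x <- B) \prod_(i | u i == v) f i x) / #|` B|%:R).
Proof.
move=> In.
under expectation_eq => s.
  rewrite (partition_big u (mem (u @: I))) /=; last by move=> i _; apply: imset_f.
  under eq_bigr => v _ do under eq_bigr => i /eqP ui do rewrite ui.
  over.
rewrite (expectation_prod (fun v x => \prod_(i | u i == v) f i x)); last first.
  exact: leq_trans (leq_imset_card _ _) In.
apply: eq_bigr => v _.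
exact: (expectation_hash v (fun x => \prod_(i | u i == v) f i x)).
Qed.

Lemma expectation_tuple_neq0 (I : finType) (u : I -> V) (f : I -> A -> C) i0 :
    (#|I| <= n)%N ->
  expectation (fun s : seed F => \prod_i f i (hash s (u i))) != 0 ->
  \sum_(x <- B) \prod_(i | u i == u i0) f i x != 0.
Proof.
move=> In; rewrite expectation_tuple // => /prodf_neq0/(_ (u i0)).
by rewrite imset_f // mulf_eq0 negb_or => /(_ isT)/andP[].
Qed.

End HashFamilies.

Lemma prod_bool2 (R : comNzRingType) (F : bool * bool -> R) (P : pred (bool * bool)) :
  \prod_(i | P i) F i =
  (if P (false, false) then F (false, false) else 1)
  * (if P (false, true) then F (false, true) else 1)
  * (if P (true, false) then F (true, false) else 1)
  * (if P (true, true) then F (true, true) else 1).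
Proof.
pose G x y := if P (x, y) then F (x, y) else 1.
rewrite big_mkcond (eq_bigr (fun i => G i.1 i.2)) => [|[x y] //].
by rewrite -(pair_bigA _ G) !big_bool /= -!/(G _ _); ring.
Qed.

Lemma pairing_no_singleton (T : eqType) (x1 x2 y1 y2 : T) :
  x1 \in [:: x2; y1; y2] -> x2 \in [:: x1; y1; y2] ->
  y1 \in [:: x1; x2; y2] -> y2 \in [:: x1; x2; y1] -> pairing x1 x2 y1 y2.
Proof.
rewrite /pairing !inE.
case/or3P=> /eqP e1; case/or3P=> /eqP e2; case/or3P=> /eqP e3; case/or3P=> /eqP e4;
by subst; rewrite ?eqxx ?orbT.
Qed.

Section FourFactors.
Variables (R : realType) (d n : nat) (V : finType).
Local Notation C := R[i].
Variables (B : {fset 'M[C]_d}) (F : hash_family V 'M[C]_d).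
Hypothesis B_char : character_group B.
Hypothesis F_unif : uniform_on R B F.
Hypothesis F_kwise : kwise_independent R n F.
Hypothesis n_ge4 : (4 <= n)%N.

(* The first component of the index says from which of the two copies of the *)
(* trace a factor comes (the second one is conjugated, with character [q]),  *)
(* the second component whether it is evaluated at the distinguished slot.   *)
Definition cross_factor (p q : 'I_d) (i : bool * bool) (A : 'M[C]_d) : C :=
  let r := if i.1 then q else p in
  if i.1 == i.2 then A r r else (A r r)^-1.

Variable u : bool * bool -> V.

Definition cross_moment p q : C :=
  expectation (fun s : seed F => \prod_i cross_factor p q i (hash s (u i))).

Let F_in v s : hash s v \in B := hash_in (cg_ex B_char) F_unif v s.

Let card_I : (#|{: bool * bool}| <= n)%N.
Proof. by rewrite card_prod card_bool. Qed.

Let moment_neq0 p q i0 : cross_moment p q != 0 ->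
  \sum_(A <- B) \prod_(i | u i == u i0) cross_factor p q i A != 0.
Proof.
exact: (expectation_tuple_neq0 (cg_ex B_char) F_unif F_kwise i0 card_I).
Qed.

Lemma norm_cross_moment p q : `|cross_moment p q| <= 1.
Proof.
apply: norm_expectation_le1 => s; rewrite normr_prod big1 // => i _.
by rewrite /cross_factor; case: ifP => _; rewrite ?normfV (cg_norm B_char) ?invr1.
Qed.

Let sum_inv p : \sum_(A <- B) (A p p)^-1 = 0.
Proof.
transitivity ((\sum_(A <- B) A p p)^*%R); last by rewrite (cg_sum B_char) rmorph0.
rewrite rmorph_sum big_seq [RHS]big_seq; apply: eq_bigr => A AB.
by rewrite invC_norm (cg_norm B_char) // expr1n invr1 mul1r.
Qed.

(** A hash value that occurs only once averages to zero independently of the others. Hence in a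
    nonzero moment each of the four points is repeated, which forces a pairing. *)
Let alone p q i0 : (forall i, u i == u i0 -> i = i0) -> cross_moment p q = 0.
Proof.
move=> al; apply/eqP; apply: contraT => /(moment_neq0 i0).
rewrite (eq_bigr (cross_factor p q i0)) => [|A _]; last first.
  by apply: big_pred1 => i /=; apply/idP/eqP => [/al|->].
rewrite /cross_factor /=; case: (i0.1 == i0.2); last by rewrite sum_inv eqxx.
by rewrite (cg_sum B_char) eqxx.
Qed.

Lemma cross_moment_pairing p q : cross_moment p q != 0 ->
  pairing (u (false, false)) (u (false, true)) (u (true, false)) (u (true, true)).
Proof.
move=> ne.
have na : forall i0, [exists i, (i != i0) && (u i == u i0)].
  move=> i0; apply: contraT => /existsPn none; move: ne; rewrite (@alone p q i0) ?eqxx //.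
  by move=> i ui; apply/eqP; have := none i; rewrite ui andbT negbK.
have ex : forall i0, exists2 i, i != i0 & u i = u i0.
  by move=> i0; have /existsP[i /andP[ni /eqP ui]] := na i0; exists i.
apply: pairing_no_singleton; rewrite !inE.
- by have [[[] []] // _ <-] := ex (false, false); rewrite eqxx ?orbT.
- by have [[[] []] // _ <-] := ex (false, true); rewrite eqxx ?orbT.
- by have [[[] []] // _ <-] := ex (true, false); rewrite eqxx ?orbT.
- by have [[[] []] // _ <-] := ex (true, true); rewrite eqxx ?orbT.
Qed.

(** Different points within one copy exclude pairing inside the copies, so [u (false, false)] is
    matched with exactly one point of the second copy. Its factor is the sum of [A p p / A q q] if
    that point is at the free slot, and of [A p p * A q q] if it is at the distinguished one;
    [cg_sumV] and [cg_sumM] apply. *)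
Lemma cross_moment_unique p q q' : cross_moment p q != 0 -> cross_moment p q' != 0 ->
  (exists s, u (s, false) != u (s, true)) -> q = q'.
Proof.
move=> neq neq' [s us]; have := cross_moment_pairing neq.
have ne0 : pairing (u (false, false)) (u (false, true)) (u (true, false)) (u (true, true)) ->
    u (false, false) != u (false, true).
  case: s us => // us; rewrite /pairing; case/or3P => /andP[/eqP e1 /eqP e2].
  - by rewrite e2 eqxx in us.
  - by rewrite e1 e2.
  - by rewrite e1 e2 eq_sym.
move=> pr; have := ne0 pr => {ne0 s us} ne.
have := moment_neq0 (false, false) neq; have := moment_neq0 (false, false) neq'.
under eq_bigr => A _ do rewrite prod_bool2.
move=> m'; under eq_bigr => A _ do rewrite prod_bool2.
move: m' pr; rewrite /pairing /cross_factor /= eqxx [u (false, true) == _]eq_sym (negPf ne).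
move=> m' /or3P[]/andP[] // /eqP e1 /eqP e2; move: m'; rewrite -e1 -e2 ?eqxx.
  rewrite [u (false, true) == _]eq_sym (negPf ne) => m' m.
  apply: (cg_sumV B_char (p := p)).
    by move: m; under eq_bigr do rewrite !mulr1.
  by move: m'; under eq_bigr do rewrite !mulr1.
rewrite [u (false, true) == _]eq_sym (negPf ne) => m' m.
apply: (cg_sumM B_char (p := p)).
  by move: m; under eq_bigr do rewrite !mulr1.
by move: m'; under eq_bigr do rewrite !mulr1.
Qed.

End FourFactors.

(** * The second moment of the trace *)

Section Endpoints.
Variables (k : nat) (V : finType).

Definition endpoint (eps : {ffun 'I_k -> V * V}) (j : slot k) : V :=
  if j.2 then (eps j.1).2 else (eps j.1).1.

Definition endpoints (o : {ffun 'I_k -> V * V} * {ffun 'I_k -> V * V})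
  (x : slot k * bool) : V := endpoint (if x.2 then o.2 else o.1) x.1.

Lemma endpoints_inj o o' : endpoints o =1 endpoints o' -> o = o'.
Proof.
case: o o' => [e1 e2] [e1' e2'] E; congr (_, _); apply/ffunP => i.
  have := E ((i, false), false); have := E ((i, true), false).
  by rewrite /endpoints /endpoint /=; case: (e1 i) (e1' i) => x y [x' y'] /= -> ->.
have := E ((i, false), true); have := E ((i, true), true).
by rewrite /endpoints /endpoint /=; case: (e2 i) (e2' i) => x y [x' y'] /= -> ->.
Qed.

End Endpoints.

Section Trace.
Variables (R : realType) (t k : nat) (a : slot k -> 'I_t).
Variables (iota : 'I_t -> slot k) (V : finType) (g : rel V) (d nc : nat).
Variable FX : free_slot a iota -> hash_family V 'M[R[i]]_d.
Variable FC : hash_family V 'I_nc.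
Variable B : {fset 'M[R[i]]_d}.
Local Notation C := R[i].
Local Notation walk := {ffun 'I_k -> V * V}.
Local Notation palette := {ffun 'I_t -> 'I_nc}.
Hypothesis iota_Gamma : forall b, iota b \in Gamma a b.
Hypothesis B_char : character_group B.
Hypothesis FX_in : forall j v (s : seed (FX j)), hash s v \in B.

Definition compatible (c : palette) (eps : walk) (s : seed FC) :=
  [forall j, hash s (endpoint eps j) == c (a j)].

(** This is the diagonal entry [p] of the product of all hashes along [eps], with the distinguished
    hashes eliminated: each free hash also occurs, inverted, at the endpoint of the distinguished
    slot of its vertex ([prod_hashX]). *)
Definition walk_char (eps : walk) (p : 'I_d) (w : sample FX FC) : C :=
  \prod_(j : free_slot a iota) (hash (w.1 j) (endpoint eps (val j)) p p
     / hash (w.1 j) (endpoint eps (iota (a (val j)))) p p).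

Section Sample.
Variable w : sample FX FC.

Lemma free_hash_diag j v : diagonal (free_hash w j v).
Proof.
rewrite /free_hash; case: insub => [j'|]; last exact: diagonal1.
exact: (cg_diag B_char).
Qed.

Lemma free_hash_norm j v p : `|free_hash w j v p p| = 1.
Proof.
rewrite /free_hash; case: insub => [j'|]; first exact: (cg_norm B_char).
by rewrite mxE eqxx normr1.
Qed.

Lemma free_hash_inv j v : diagonal (invmx (free_hash w j v)) /\
  forall p, invmx (free_hash w j v) p p = (free_hash w j v p p)^-1.
Proof.
apply: diagonal_invmx; first exact: free_hash_diag.
by move=> p; rewrite unitfE -normr_gt0 free_hash_norm.
Qed.

Lemma hashX_diag j v : diagonal (hashX w j v).
Proof.
rewrite /hashX; case: ifP => _; last exact: free_hash_diag.
by apply: diagonal_prod => i _; have [] := free_hash_inv i v.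
Qed.

Lemma hashX_entry j v p : hashX w j v p p =
  if j == iota (a j)
  then \prod_(j' in Gamma a (a j) | j' != j) (free_hash w j' v p p)^-1
  else free_hash w j v p p.
Proof.
rewrite /hashX; case: ifP => // _; rewrite diagonal_prodE => [|i _].
  by apply: eq_bigr => i _; have [_ ->] := free_hash_inv i v.
by have [] := free_hash_inv i v.
Qed.

Lemma prod_hashX (u : slot k -> V) p :
  \prod_j hashX w j (u j) p p =
  \prod_(j : free_slot a iota) (hash (w.1 j) (u (val j)) p p
     / hash (w.1 j) (u (iota (a (val j)))) p p).
Proof.
have ai b : a (iota b) = b by have := iota_Gamma b; rewrite inE => /eqP.
rewrite (bigID (fun j => j == iota (a j))) /=.
rewrite (reindex_onto iota a) /=; last by move=> j /eqP <-.
rewrite (eq_bigl predT) => [|b]; last by rewrite ai !eqxx.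
have -> : \prod_(b : 'I_t) hashX w (iota b) (u (iota b)) p p =
  \prod_(j | j != iota (a j)) (free_hash w j (u (iota (a j))) p p)^-1.
  rewrite [RHS](partition_big a predT) //=; apply: eq_bigr => b _.
  rewrite hashX_entry ai eqxx; apply: eq_big => [j|j /andP[]].
    by rewrite inE; case: (a j =P b) => [->|]; rewrite ?andbF ?andbT.
  by rewrite inE => /eqP ->.
rewrite -big_split /= (big_sub [pred j | j != iota (a j)]) /=.
apply: eq_bigr => j _.
have fh v : free_hash w (val j) v = hash (w.1 j) v by rewrite /free_hash valK.
by rewrite hashX_entry (negPf (valP j)) !fh mulrC.
Qed.

Lemma trace_expand : \tr (Ssum g w) =
  \sum_(eps : walk | [forall i, eps i \in directed_edges g])
   \sum_(c : palette | injectiveb c)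
     (compatible c eps w.2)%:R * \sum_p walk_char eps p w.
Proof.
have -> : \tr (Ssum g w) =
    \sum_p \sum_(c : palette | injectiveb c) Scol g w c p p.
  by apply: eq_bigr => p _; rewrite summxE.
rewrite exchange_big /= [RHS]exchange_big /=; apply: eq_bigr => c _.
have dE i e : diagonal (edge_hash w i e) by apply: diagonal_mulmx; apply: hashX_diag.
under eq_bigr => p _.
  rewrite /Scol diagonal_prodE; last by move=> i _; apply: diagonal_sum.
  under eq_bigr => i _ do rewrite /Zsum summxE.
  rewrite bigA_distr_big_dep /=.
  over.
rewrite exchange_big /= big_mkcond [RHS]big_mkcond /=; apply: eq_bigr => eps _.
have -> : (eps \in family (fun i => [pred p in directed_edges g |
    (coloring w p.1 == c (a (i, false))) && (coloring w p.2 == c (a (i, true)))]))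
  = [forall i, eps i \in directed_edges g] && compatible c eps w.2.
  apply/familyP/andP => [h|[/forallP h1 /forallP h2] i].
    split; apply/forallP => i; first by have := h i; rewrite inE => /andP[].
    by case: i => i []; have := h i; rewrite inE => /andP[_ /andP[]].
  rewrite inE h1 /=; apply/andP; split.
    exact: (h2 (i, false)).
  exact: (h2 (i, true)).
case: [forall i, _] => //=; case: (compatible _ _ _); rewrite ?mul0r // mul1r.
apply: eq_bigr => p _; rewrite /walk_char -prod_hashX.
transitivity (\prod_(i < k) \prod_(b : bool) hashX w (i, b) (endpoint eps (i, b)) p p).
  apply: eq_bigr => i _; rewrite big_bool.
  apply: etrans (mulrC _ _); exact: (diagonal_mxE _ _ _ (hashX_diag _ _)).
rewrite (pair_bigA _ (fun i b => hashX w (i, b) (endpoint eps (i, b)) p p)) /=.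
by apply: eq_bigr => -[].
Qed.

End Sample.

Definition pair_moment (o : walk * walk) (p q : 'I_d) : C :=
  \prod_(j : free_slot a iota) cross_moment (FX j)
     (fun x => endpoints o ((if x.2 then iota (a (val j)) else val j), x.1)) p q.

Lemma second_moment_trace :
  expectation (fun w : sample FX FC => `|\tr (Ssum g w)| ^+ 2) =
  \sum_(o : walk * walk | [forall i, o.1 i \in directed_edges g] &&
                          [forall i, o.2 i \in directed_edges g])
    (\sum_(c : palette | injectiveb c) \sum_(c' : palette | injectiveb c')
      (Pr R [pred s : seed FC | compatible c o.1 s && compatible c' o.2 s])%:C)
    * \sum_p \sum_q pair_moment o p q.
Proof.
pose good (e : walk) := [forall i, e i \in directed_edges g].
pose chi2 (o : walk * walk) p q (f : {dffun forall i : free_slot a iota, seed (FX i)}) :=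
  \prod_j \prod_i cross_factor p q i (hash (f j)
   (endpoints o ((if i.2 then iota (a (val j)) else val j), i.1))).
have E (w : sample FX FC) : `|\tr (Ssum g w)| ^+ 2 =
  \sum_(o : walk * walk | good o.1 && good o.2)
  \sum_(c : palette | injectiveb c) \sum_(c' : palette | injectiveb c') \sum_p \sum_q
   chi2 o p q w.1 * (compatible c o.1 w.2 && compatible c' o.2 w.2)%:R.
  rewrite normCK !trace_expand rmorph_sum /= big_distrlr /=.
  rewrite (pair_big_dep good (fun _ => good)) /=; apply: eq_bigr => -[e e'] _ /=.
  rewrite rmorph_sum /= big_distrlr /=; apply: eq_bigr => c _; apply: eq_bigr => c' _.
  rewrite rmorphM rmorph_sum rmorph_nat /= mulrACA -natrM mulnb mulrC.
  rewrite big_distrlr /= mulr_suml; apply: eq_bigr => p _.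
  rewrite mulr_suml; apply: eq_bigr => q _; congr (_ * _).
  rewrite /walk_char rmorph_prod -big_split /=; apply: eq_bigr => j _.
  rewrite prod_bool2 /cross_factor /= /endpoints /=.
  rewrite rmorphM fmorphV /=.
  have cj (v : V) : ((hash (w.1 j) v q q)^*%R) = (hash (w.1 j) v q q)^-1.
    by rewrite invC_norm (cg_norm B_char) // expr1n invr1 mul1r.
  by rewrite !cj invrK; ring.
under expectation_eq => w do rewrite E.
rewrite expectation_sum; apply: eq_bigr => o _.
rewrite expectation_sum mulr_suml; apply: eq_bigr => c _.
rewrite expectation_sum mulr_suml; apply: eq_bigr => c' _.
rewrite expectation_sum mulr_sumr; apply: eq_bigr => p _.
rewrite expectation_sum mulr_sumr; apply: eq_bigr => q _.
rewrite (expectation_pair (chi2 o p q)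
  (fun s : seed FC => (compatible c o.1 s && compatible c' o.2 s)%:R)).
rewrite Pr_complex mulrC; congr (_ * _).
rewrite /chi2 (expectation_dffun (fun j s => \prod_i cross_factor p q i (hash s
   (endpoints o ((if i.2 then iota (a (val j)) else val j), i.1))))).
by [].
Qed.

Section MomentBounds.
Hypothesis FX_unif : forall j, uniform_on R B (FX j).
Variable n : nat.
Hypothesis FX_kwise : forall j, kwise_independent R n (FX j).
Hypothesis n_ge4 : (4 <= n)%N.
Variable o : walk * walk.

Let norm_pair_moment p q : `|pair_moment o p q| <= 1.
Proof.
rewrite normr_prod; apply: prodr_ile1 => j _; rewrite normr_ge0 /=.
exact: (norm_cross_moment B_char (FX_unif j)).
Qed.

Let pair_moment_neq0 p q j : pair_moment o p q != 0 ->
  cross_moment (FX j) (fun x =>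
    endpoints o ((if x.2 then iota (a (val j)) else val j), x.1)) p q != 0.
Proof. by move/prodf_neq0/(_ j isT). Qed.

Lemma pair_moment_sum_le : `|\sum_p \sum_q pair_moment o p q| <= (d ^ 2)%:R.
Proof.
apply: le_trans (ler_norm_sum _ _ _) _.
apply: (@le_trans _ _ (\sum_(p < d) d%:R)); last first.
  by rewrite sumr_const card_ord -mulrnA.
apply: ler_sum => p _; apply: le_trans (ler_norm_sum _ _ _) _.
apply: le_trans (ler_sum _ (fun q _ => norm_pair_moment p q)) _.
by rewrite sumr_const card_ord.
Qed.

Lemma pair_moment_sum_paired : \sum_p \sum_q pair_moment o p q != 0 ->
  paired a iota (endpoints o).
Proof.
move=> ne j nj.
have [/existsP[p /existsP[q pq]]|/existsPn z] :=
  boolP [exists p, exists q, pair_moment o p q != 0]; last first.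
  case/eqP: ne; apply: big1 => p _; apply: big1 => q _.
  by apply/eqP; have /existsPn/(_ q) := z p; rewrite negbK.
pose j' : free_slot a iota := Sub j nj.
have := cross_moment_pairing B_char (FX_unif j') (FX_kwise j') n_ge4
  (pair_moment_neq0 j' pq).
by [].
Qed.

(** The slot where purity fails is free and differs from its distinguished slot within one copy, so
    [cross_moment_unique] leaves at most one [q] for each [p]. *)
Lemma pair_moment_sum_notpure : ~~ [forall b, pure a iota (endpoints o) b] ->
  `|\sum_p \sum_q pair_moment o p q| <= d%:R.
Proof.
case/forallPn => b /forall_inPn[j jb /forallPn[s ne]].
move: jb; rewrite inE => /eqP jb.
have nj : j != iota (a j) by apply: contraNneq ne => ->; rewrite jb.
pose j' : free_slot a iota := Sub j nj.
apply: le_trans (ler_norm_sum _ _ _) _.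
apply: (@le_trans _ _ (\sum_(p < d) 1)); last by rewrite sumr_const card_ord.
apply: ler_sum => p _.
have [/existsP[q nq]|/existsPn z] := boolP [exists q, pair_moment o p q != 0]; last first.
  rewrite big1 ?normr0 ?ler01 // => q _.
  by apply/eqP; have := z q; rewrite negbK.
rewrite (bigD1 q) //= big1 ?addr0 ?norm_pair_moment // => q' /eqP nqq.
apply/eqP; apply: contraT => nq'; case: nqq.
apply: (cross_moment_unique B_char (FX_unif j') (FX_kwise j') n_ge4
  (pair_moment_neq0 j' nq') (pair_moment_neq0 j' nq)).
by exists s; rewrite /= jb.
Qed.

End MomentBounds.

End Trace.

(** * Embeddings of H and numerical estimates *)

(** Meant for sums in which only the product of class size and weight is controlled: in a class of n
    elements each weight is at most X / n. *)
Lemma sum_le_fiber (R : realFieldType) (T S : finType) (f : T -> S) (A : {set T})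
    (F : T -> R) (X : R) :
    0 <= X ->
    (forall o, o \in A -> #|[set o' in A | f o' == f o]|%:R * F o <= X) ->
  \sum_(o in A) F o <= #|S|%:R * X.
Proof.
move=> X0 FX; rewrite (partition_big f predT) //=.
apply: (@le_trans _ _ (\sum_(y : S) X)); last by rewrite sumr_const mulr_natl.
apply: ler_sum => y _.
pose n := #|[set o' in A | f o' == y]|.
have [n0|n0] := posnP n.
  rewrite big1 // => o oAy; move/eqP: n0; rewrite cards_eq0 => /eqP/setP/(_ o).
  by rewrite !inE oAy.
have nR : 0 < n%:R :> R by rewrite ltr0n.
apply: (@le_trans _ _ (\sum_(o | (o \in A) && (f o == y)) X / n%:R)).
  apply: ler_sum => o /andP[oA /eqP fo]; rewrite ler_pdivlMr // mulrC.
  by have := FX o oA; rewrite fo.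
rewrite sumr_const -(mulr_natr (X / _)) (_ : #|_| = n) ?divfK ?gt_eqF //.
by apply: eq_card => o; rewrite !inE.
Qed.

(* The map from injective homomorphisms to their image subgraphs has fibers *)
(* of at most [t ^ t] elements.                                             *)
Lemma card_injective_hom (t : nat) (h : rel 'I_t) (V : finType) (g : rel V) :
  simple_graph h -> simple_graph g ->
  (#|[set f : {ffun 'I_t -> V} | injectiveb f &
      [forall x, forall y, h x y ==> g (f x) (f y)]]|
   <= t ^ t * subgraph_count h g)%N.
Proof.
move=> [hs hi] [gs gi]; set IH := [set f | _ & _].
pose S (f : {ffun 'I_t -> V}) : {set V} * {set {set V}} :=
  ([set f x | x : 'I_t], [set [set f p.1; f p.2] | p : 'I_t * 'I_t & h p.1 p.2]).
apply: (@leq_trans #|id @: IH|); first by rewrite imset_id.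
rewrite mulnC; apply: (@leq_trans (#|S @: IH| * t ^ t)%N).
  apply: leq_card_imset_fiber => f fIH.
  apply: (@leq_trans #|[set f' | f' in
      [pred f' : {ffun 'I_t -> V} | f' \in ffun_on (mem (S f).1)]]|).
    apply: subset_leq_card; apply/subsetP => _ /imsetP[f' + ->].
    rewrite inE => /andP[_ /eqP Sf]; apply: imset_f; rewrite inE -Sf.
    by apply/ffun_onP => x; apply: imset_f.
  apply: leq_trans (leq_imset_card _ _) _; rewrite card_ffun_on card_ord.
  have mono p q n : (p <= q -> p ^ n <= q ^ n)%N by case: n => // n; rewrite leq_exp2r.
  by apply: mono; apply: leq_trans (leq_imset_card _ _) _; rewrite card_ord.
rewrite leq_mul2r; apply/orP; right; apply: subset_leq_card.
apply/subsetP => _ /imsetP[f + ->]; rewrite !inE => /andP[/injectiveP fi /forallP fh].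
have gf x y : h x y -> g (f x) (f y).
  by move=> hxy; have /forallP/(_ y)/implyP/(_ hxy) := fh x.
apply/andP; split.
  apply/andP; split.
    apply/subsetP => _ /imsetP[[x y] /[!inE] /= hxy ->].
    by apply/imsetP; exists (f x, f y); rewrite ?inE /= ?gf.
  apply/forall_inP => _ /imsetP[[x y] _ ->] /=.
  by rewrite subUset !sub1set !imset_f.
apply/existsP; exists f; rewrite eqxx /=; apply/andP; split; first exact/injectiveP.
apply/forallP => x; apply/forallP => y; apply/eqP; apply/idP/idP.
  by move=> hxy; apply/imsetP; exists (x, y); rewrite ?inE.
case/imsetP => -[x' y'] /[!inE] /= hxy.
have nxy : f x' != f y' by apply: contraTneq hxy => /fi ->; rewrite hi.
by case/(set2_inj nxy) => -[/fi -> /fi ->] //; rewrite hs.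
Qed.

(** As m = c D^2, the count satisfies N <= c^f D^u, so N P <= c^(f+np+t) (D/c)^u. Both bases are at
    least 1, the second because c^3 <= m, so the exponents may be raised to k+t and 2k; finally
    (D/c)^2 = m/c^3. *)
Lemma weight_bound (R : realFieldType) (N D m c P : R) (f u np t k : nat) :
  0 < c -> 0 < m -> 0 <= D -> D ^+ 2 = m / c -> c ^+ 3 <= m ->
  0 <= P -> P <= c ^+ (t + np) / c ^+ u ->
  N * (D ^+ 2) ^+ f <= m ^+ f * D ^+ u ->
  (f + np <= k)%N -> (u <= 2 * k)%N -> (t <= 2 * k)%N -> 1 <= c ->
  N * P <= m ^+ k / c ^+ (2 * k - t).
Proof.
move=> c0 m0 D0 D2 c3 P0 Ple Nle fk uk tk c1.
have cn0 n : 0 < c ^+ n by rewrite exprn_gt0.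
have N1 : N <= c ^+ f * D ^+ u.
  have mf : 0 < m ^+ f by rewrite exprn_gt0.
  rewrite -(ler_pM2r (divr_gt0 mf (cn0 f))).
  have -> : c ^+ f * D ^+ u * (m ^+ f / c ^+ f) = m ^+ f * D ^+ u.
    by rewrite mulrAC mulrCA mulfV ?gt_eqF // mulr1.
  by rewrite -expr_div_n -D2.
have cD : 1 <= D / c.
  rewrite ler_pdivlMr // mul1r -(ler_pXn2r (isT : (0 < 2)%N)) ?nnegrE ?(ltW c0) // D2.
  by rewrite ler_pdivlMr // -exprSr.
apply: (@le_trans _ _ ((c ^+ f * D ^+ u) * (c ^+ (t + np) / c ^+ u))).
  apply: (@le_trans _ _ ((c ^+ f * D ^+ u) * P)); first exact: ler_wpM2r.
  by apply: ler_wpM2l => //; rewrite mulr_ge0 ?exprn_ge0 ?(ltW c0).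
have -> : c ^+ f * D ^+ u * (c ^+ (t + np) / c ^+ u) = c ^+ (f + np + t) * (D / c) ^+ u.
  by rewrite expr_div_n !exprD; ring.
apply: (@le_trans _ _ (c ^+ (k + t) * (D / c) ^+ (2 * k))).
  apply: ler_pM; rewrite ?exprn_ge0 ?divr_ge0 ?(ltW c0) //.
    by apply: ler_weXn2l => //; rewrite leq_add2r.
  exact: ler_weXn2l.
rewrite ler_pdivlMr // exprM expr_div_n D2 mulrAC -exprD.
have -> : (k + t + (2 * k - t) = 3 * k)%N by lia.
rewrite exprM -exprMn (_ : c ^+ 3 * _ = m) //.
by field; rewrite gt_eqF.
Qed.

(** The two bounds involving [alpha] combine to Delta^2 C <= m^(1-2 alpha) m^(2 alpha) = m.
    Positivity of m comes from 1 <= C <= m^(1/3). *)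
Lemma density_bounds (R : realType) (m nc Delta : nat) (alpha : R) :
  (0 < nc)%N ->
  Delta%:R <= powR m%:R (2^-1 - alpha) ->
  nc%:R <= Num.min (powR m%:R (2 * alpha)) (powR m%:R 3^-1) ->
  [/\ 0 < m%:R :> R, nc%:R ^+ 3 <= m%:R :> R &
      Delta%:R <= Num.sqrt (m%:R / nc%:R) :> R].
Proof.
move=> nc0 leD; rewrite le_min => /andP[le1 le2].
have ncR : 0 < nc%:R :> R by rewrite ltr0n.
have m0 : 0 < m%:R :> R.
  rewrite ltr0n lt0n; apply: contraTneq le2 => ->.
  by rewrite powR0 ?invr_eq0 ?pnatr_eq0 // -ltNge.
split=> //.
  have -> : m%:R = powR m%:R 3^-1 ^+ 3 :> R.
    by rewrite -powR_mulrn ?powR_ge0 // -powRrM mulVf ?powRr1 ?pnatr_eq0 // ltW.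
  by rewrite lerXn2r // nnegrE ?ler0n ?powR_ge0.
rewrite -(ler_pXn2r (isT : (0 < 2)%N)) ?nnegrE ?ler0n ?sqrtr_ge0 //.
rewrite sqr_sqrtr ?divr_ge0 ?ler0n // ler_pdivlMr //.
apply: (@le_trans _ _ (powR m%:R (2^-1 - alpha) ^+ 2 * powR m%:R (2 * alpha))).
  apply: ler_pM; rewrite ?exprn_ge0 ?ler0n //.
  by rewrite lerXn2r // nnegrE ?ler0n ?powR_ge0.
rewrite -powR_mulrn ?powR_ge0 // -powRrM -powRD; last first.
  by rewrite (gt_eqF m0) implybT.
have -> : (2^-1 - alpha) * 2%:R + 2 * alpha = 1 :> R by field.
by rewrite powRr1 // ltW.
Qed.

(** Factor by factor, n <= t (n - i) for i < t <= n. This bounds the normalization of the estimator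
    by a constant depending on t only. *)
Lemma expn_le_ffact t n : (t <= n)%N -> (n ^ t <= t ^ t * n ^_ t)%N.
Proof.
move=> tn; rewrite ffact_prod -{1 3}(card_ord t) -!prod_nat_const -big_split /=.
by apply: leq_prod => i _; have := ltn_ord i; nia.
Qed.

(** * Colorings *)

Section Colors.
Variables (R : realType) (t k : nat) (a : slot k -> 'I_t).
Variables (iota : 'I_t -> slot k) (V : finType) (nc : nat).
Variable FC : hash_family V 'I_nc.
Local Notation walk := {ffun 'I_k -> V * V}.
Local Notation palette := {ffun 'I_t -> 'I_nc}.
Hypothesis iota_Gamma : forall b, iota b \in Gamma a b.
Hypothesis FC_kwise : kwise_independent R (4 * k) FC.
Hypothesis FC_unif : uniform_on R [fset c | c in 'I_nc]%fset FC.
Variable o : walk * walk.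
Let w := endpoints o.

Definition color_weight : R :=
  \sum_(c : palette | injectiveb c) \sum_(c' : palette | injectiveb c')
    Pr R [pred s : seed FC | compatible a c o.1 s && compatible a c' o.2 s].

Let compatibleE (c c' : palette) (s : seed FC) :
  compatible a c o.1 s && compatible a c' o.2 s =
  [forall x, hash s (w x) == (if x.2 then c' else c) (a x.1)].
Proof.
apply/andP/forallP => [[/forallP h1 /forallP h2] [j []] | h].
- exact: h2.
- exact: h1.
by split; apply/forallP => j; [have := h (j, false)|have := h (j, true)].
Qed.

Let ai b : a (iota b) = b.
Proof. by have := iota_Gamma b; rewrite inE => /eqP. Qed.

Lemma color_weight_ge0 : 0 <= color_weight.
Proof. by do 2!apply: sumr_ge0 => ? _; rewrite divr_ge0 ?ler0n. Qed.

Let compatible_exists (c c' : palette) :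
  Pr R [pred s : seed FC | compatible a c o.1 s && compatible a c' o.2 s] != 0 ->
  exists s : seed FC, forall x, hash s (w x) = (if x.2 then c' else c) (a x.1).
Proof.
rewrite /Pr mulf_eq0 negb_or pnatr_eq0 => /andP[n0 _].
have /card_gt0P[s] : (0 < #|[pred s : seed FC |
    compatible a c o.1 s && compatible a c' o.2 s]|)%N.
  by rewrite lt0n.
by rewrite inE compatibleE => /forallP h; exists s => x; apply/eqP.
Qed.

(** A compatible coloring agrees on the image of [w] with any fixed compatible one. The image has at
    most 4k points, the number of slots in two walks, so independence applies. *)
Let Pr_compatible (c c' : palette) :
  Pr R [pred s : seed FC | compatible a c o.1 s && compatible a c' o.2 s]
  <= (nc%:R ^+ #|[set w x | x : slot k * bool]|)^-1.
Proof.
set E := [pred s | _]; have [->|ne] := eqVneq (Pr R E) 0.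
  by rewrite invr_ge0 exprn_ge0.
have [s0 hs0] := compatible_exists ne.
set U := [set _ | _ in _].
have U4 : (#|U| <= 4 * k)%N.
  apply: leq_trans (leq_imset_card _ _) _.
  by rewrite !card_prod card_ord card_bool; lia.
have <- : Pr R [pred s : seed FC | [forall v in U, hash s v == hash s0 v]] =
    (nc%:R ^+ #|U|)^-1.
  rewrite (FC_kwise _ U4) -exprVn -prodr_const; apply: eq_bigr => v _.
  rewrite FC_unif; last by rewrite !inE.
  by rewrite card_imfset //= -cardE card_ord.
rewrite /Pr ler_wpM2r ?invr_ge0 ?ler0n // ler_nat; apply: subset_leq_card.
apply/subsetP => s; rewrite !inE compatibleE => /forallP h.
by apply/forall_inP => _ /imsetP[x _ ->]; rewrite hs0.
Qed.

(** At a vertex that is not pure, the two copies share a vertex of G by [notpure_swap], so [c'] is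
    forced to agree with [c] there. This leaves at most C^t C^np pairs of palettes, each of
    probability at most C^(-u). *)
Lemma color_weight_paired : paired a iota w ->
  color_weight <= nc%:R ^+ (t + #|[set b | pure a iota w b]|)
                  / nc%:R ^+ #|[set w x | x : slot k * bool]|.
Proof.
move=> wp; set np := #|_|; set u := #|_|.
pose Q (c : palette) b : pred 'I_nc :=
  [pred c' | pure a iota w b || (c' == c b)].
have step (c : palette) : \sum_(c' : palette | injectiveb c')
    Pr R [pred s : seed FC | compatible a c o.1 s && compatible a c' o.2 s]
    <= nc%:R ^+ np / nc%:R ^+ u.
  apply: (@le_trans _ _ (\sum_(c' in family (Q c)) (nc%:R ^+ u)^-1)).
    rewrite big_mkcond [leRHS]big_mkcond /=; apply: ler_sum => c' _.
    case: ifP => _; last by case: ifP; rewrite // invr_ge0 exprn_ge0.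
    case: ifP => [_|/negP nf]; first exact: Pr_compatible.
    rewrite le_eqVlt; apply/orP; left; apply: contraT => /compatible_exists[s hs].
    case: nf; apply/familyP => b; rewrite inE.
    have [//|npb] := boolP (pure a iota w b).
    have [j' aj' e] := notpure_swap iota_Gamma wp false npb (ai b).
    apply/eqP; have := hs (j', true); rewrite /= aj' => <-.
    by have := hs (iota b, false); rewrite /= ai => <-; rewrite e.
  rewrite sumr_const -[leLHS]mulr_natl; apply: ler_wpM2r.
    by rewrite invr_ge0 exprn_ge0.
  have -> : #|family (Q c)|%:R = \prod_b \sum_(x in Q c b) 1 :> R.
    rewrite bigA_distr_big_dep /= -sum1_card natr_sum.
    by apply: eq_bigr => f _; rewrite big1_eq.
  rewrite [leRHS](_ : _ = \prod_(b : 'I_t) (if pure a iota w b then nc%:R else 1)).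
    apply: ler_prod => b _; rewrite sumr_ge0 //= sumr_const.
    case: ifP => pb.
      by rewrite ler_nat -[leqRHS](card_ord nc) max_card.
    rewrite (_ : #|_| = 1%N) // -(card1 (c b)); apply: eq_card => c'.
    by rewrite !inE pb.
  rewrite -big_mkcond prodr_const; congr (_ ^+ _).
  by apply: eq_card => b; rewrite !inE.
apply: (@le_trans _ _ (\sum_(c : palette) nc%:R ^+ np / nc%:R ^+ u)).
  rewrite /color_weight big_mkcond /=; apply: ler_sum => c _; case: ifP => _ //.
  by rewrite divr_ge0 ?exprn_ge0.
by rewrite sumr_const card_ffun !card_ord -[leLHS]mulr_natl natrX exprD mulrA.
Qed.

(** A coloring determines both palettes, which can be read off at the distinguished slots; so each
    seed is counted at most once. *)
Lemma color_weight_le1 : color_weight <= 1.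
Proof.
pose c0 (e : walk) (s : seed FC) : palette := [ffun b => hash s (endpoint e (iota b))].
have uq (e : walk) (c : palette) s : compatible a c e s -> c = c0 e s.
  move=> /forallP h; apply/ffunP => b; rewrite ffunE.
  by have /eqP -> := h (iota b); rewrite ai.
rewrite /color_weight /Pr.
under eq_bigr do rewrite -mulr_suml; rewrite -mulr_suml.
have [->|n0] := posnP #|seed FC|; first by rewrite invr0 mulr0 ler01.
rewrite ler_pdivrMr ?ltr0n // mul1r.
apply: (@le_trans _ _ (\sum_(c : palette) \sum_(c' : palette) \sum_(s : seed FC)
    ((c == c0 o.1 s) && (c' == c0 o.2 s))%:R)).
  rewrite big_mkcond /=; apply: ler_sum => c _; case: ifP => _; last first.
    by do 2!apply: sumr_ge0 => ? _.
  rewrite big_mkcond /=; apply: ler_sum => c' _; case: ifP => _; last first.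
    by apply: sumr_ge0 => ? _.
  rewrite -sum1_card natr_sum big_mkcond /=; apply: ler_sum => s _.
  by rewrite inE; case: ifP => // /andP[/uq <- /uq <-]; rewrite !eqxx.
rewrite pair_bigA exchange_big /= -[X in X%:R]sum1_card natr_sum; apply: ler_sum => s _.
rewrite (bigD1 (c0 o.1 s, c0 o.2 s)) //= !eqxx big1 ?addr0 // => -[c c'] /= ne.
by case: eqP => // e1; case: eqP => // e2; rewrite e1 e2 eqxx in ne.
Qed.

Lemma color_weight_neq0 : color_weight != 0 ->
  exists c c' : palette, exists s : seed FC, [/\ injective c, injective c' &
    forall x, hash s (w x) = (if x.2 then c' else c) (a x.1)].
Proof.
move=> ne.
have [/existsP[c /existsP[c' /and3P[ci ci' n0]]]|none] := boolP
  [exists c : palette, exists c' : palette, [&& injectiveb c, injectiveb c' &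
    Pr R [pred s : seed FC | compatible a c o.1 s && compatible a c' o.2 s] != 0]].
  have [s hs] := compatible_exists n0.
  by exists c, c', s; split=> //; apply/injectiveP.
case/eqP: ne; apply: big1 => c ci; apply: big1 => c' ci'.
have /existsPn/(_ c') := existsPn none c; rewrite ci ci' /= negbK.
by move/eqP.
Qed.

End Colors.

(** * Counting pairs of walks *)

Section PairCounts.
Variables (R : realType) (t k : nat) (h : rel 'I_t) (a : slot k -> 'I_t).
Variables (iota : 'I_t -> slot k) (V : finType) (g : rel V) (nc : nat).
Variable FC : hash_family V 'I_nc.
Local Notation walk := {ffun 'I_k -> V * V}.
Hypothesis h_simple : simple_graph h.
Hypothesis h_conn : connected_graph h.
Hypothesis h_leaf : no_leaves h.
Hypothesis a_orient : is_orientation h a.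
Hypothesis iota_Gamma : forall b, iota b \in Gamma a b.
Hypothesis g_simple : simple_graph g.
Hypothesis FC_kwise : kwise_independent R (4 * k) FC.
Hypothesis FC_unif : uniform_on R [fset c | c in 'I_nc]%fset FC.

Definition walk_pair (o : walk * walk) :=
  [forall i, o.1 i \in directed_edges g] && [forall i, o.2 i \in directed_edges g].

Definition all_pure (o : walk * walk) := [forall b, pure a iota (endpoints o) b].

Lemma walk_pair_edge o x y :
  walk_pair o -> partner x y -> g (endpoints o x) (endpoints o y).
Proof.
have [gs _] := g_simple.
case/andP => /forallP o1 /forallP o2; case: x => [[i e] s] /eqP -> {y}.
rewrite /endpoints /endpoint /=.
have := o1 i; have := o2 i; rewrite !inE => g2 g1.
by case: s; case: e => //=; rewrite gs.
Qed.

(** A pure pair is determined by its values at the distinguished slots, which form two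
    homomorphisms. Nonzero color weight supplies a coloring that gives distinct vertices of [h]
    distinct colors, whence injectivity. *)
Lemma card_pure_pairs :
  (#|[set o | [&& walk_pair o, all_pure o & color_weight R a FC o != 0%R]]|
   <= (t ^ t * subgraph_count h g) ^ 2)%N.
Proof.
set P := [set o | _].
have IHle := card_injective_hom h_simple g_simple.
set IH := [set f | _ & _] in IHle.
pose phi (s : bool) (o : walk * walk) : {ffun 'I_t -> V} :=
  [ffun b => endpoints o (iota b, s)].
have pE o j s : o \in P -> endpoints o (j, s) = phi s o (a j).
  by rewrite inE => /and3P[_ /forallP pu _]; rewrite ffunE (pureP s (pu (a j))).
rewrite -(card_in_imset (f := fun o => (phi false o, phi true o))); last first.
  move=> o o' oP oP' [e1 e2]; apply: endpoints_inj => -[j s]; rewrite !pE //.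
  by case: s; rewrite ?e1 ?e2.
apply: (@leq_trans #|setX IH IH|); last first.
  by rewrite cardsX mulnn leq_exp2r.
apply: subset_leq_card; apply/subsetP => _ /imsetP[o oP ->].
suff hom s : phi s o \in IH by rewrite inE /= !hom.
have := oP; rewrite inE => /and3P[wo _ /color_weight_neq0[c [c' [q [ci ci' hq]]]]].
rewrite inE; apply/andP; split.
  apply/injectiveP => b b'; rewrite !ffunE => e.
  have := hq (iota b, s); rewrite e hq /= !(a_iota iota_Gamma).
  by case: (s); [move/ci'|move/ci].
apply/forallP => x; apply/forallP => y; apply/implyP => hxy.
have [j <- <-] := orient_onto h_simple a_orient hxy.
by rewrite -!pE //; apply: walk_pair_edge wo _; rewrite /partner.
Qed.

(** Pairs are classified by their coincidence pattern [ker], of which there is a bounded number in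
    terms of k. On one class [hom_count] bounds the size, [color_weight_paired] the weight, and
    [weight_bound] their product. *)
Lemma sum_paired_pairs (A : {set walk * walk}) :
  (0 < nc)%N -> (0 < #|directed_edges g|)%N ->
  nc%:R ^+ 3 <= #|directed_edges g|%:R :> R ->
  (max_degree g)%:R <= Num.sqrt (#|directed_edges g|%:R / nc%:R) :> R ->
  (forall o, o \in A -> [/\ walk_pair o, paired a iota (endpoints o)
     & ~~ all_pure o]) ->
  \sum_(o in A) color_weight R a FC o <=
  #|{: {ffun (slot k * bool) * (slot k * bool) -> bool}}|%:R *
  (#|directed_edges g|%:R ^+ k / nc%:R ^+ (2 * k - t)).
Proof.
set m := #|directed_edges g|; move=> nc0 m0 c3 leD hA.
have ncR : 0 < nc%:R :> R by rewrite ltr0n.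
have mR : 0 < m%:R :> R by rewrite ltr0n.
pose ker (o : walk * walk) : {ffun (slot k * bool) * (slot k * bool) -> bool} :=
  [ffun xy => endpoints o xy.1 == endpoints o xy.2].
apply: (sum_le_fiber (f := ker)).
  by rewrite divr_ge0 ?exprn_ge0.
move=> o oA; have [wo po npo] := hA o oA.
have [gs gi] := g_simple.
have kerP o' x y : ker o' = ker o ->
    (endpoints o' x == endpoints o' y) = (endpoints o x == endpoints o y).
  by move=> /ffunP/(_ (x, y)); rewrite !ffunE.
set D := Num.sqrt _ in leD.
have count := hom_count (ev := @endpoints k V) (g := g) (e := @partner k)
  (w0 := endpoints o) (H := [set o' in A | ker o' == ker o]) (@endpoints_inj k V)
  (@partner_sym k) (@partner_total k) _ _ _ leD.
apply: (weight_bound (D := D)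
  (f := #|[set fingraph.root (adj_or_eq (@partner k) (endpoints o)) x | x : slot k * bool]|)
  (u := #|[set endpoints o x | x : slot k * bool]|)
  (np := #|[set b | pure a iota (endpoints o) b]|)) => //.
- exact: sqrtr_ge0.
- by rewrite sqr_sqrtr // divr_ge0.
- exact: color_weight_ge0.
- exact: color_weight_paired.
- apply: count.
  + move=> x y xy; apply/negP => /eqP e.
    by have := walk_pair_edge wo xy; rewrite e gi.
  + move=> o'; rewrite inE => x y /andP[/hA[wo' _ _] _]; exact: walk_pair_edge.
  + move=> o' x y; rewrite inE => /andP[_ /eqP ko] /eqP e; apply/eqP.
    by rewrite kerP.
- exact: (components_add_pure h_simple h_conn h_leaf a_orient iota_Gamma po npo).
- exact: (card_image_paired h_simple h_leaf a_orient iota_Gamma po).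
- by have := leq_t_k h_simple h_leaf a_orient iota_Gamma; lia.
- by rewrite ler1n.
Qed.

End PairCounts.

(** * The variance bound *)

Lemma norm_estimator_le (R : realType) (t k : nat) (h : rel 'I_t)
    (a : slot k -> 'I_t) (iota : 'I_t -> slot k) (V : finType) (g : rel V)
    (d nc : nat) (FX : free_slot a iota -> hash_family V 'M[R[i]]_d)
    (FC : hash_family V 'I_nc) (w : sample FX FC) : (t <= nc)%N ->
  `|estimator h g w| ^+ 2 <= ((t ^ t)%:R / d%:R) ^+ 2 * `|\tr (Ssum g w)| ^+ 2.
Proof.
move=> tnc; rewrite -exprMn lerXn2r ?nnegrE ?mulr_ge0 ?invr_ge0 ?ler0n ?normr_ge0 //.
rewrite /estimator !normrM !normfV !normr_nat natrM invfM.
rewrite [leLHS]mulrCA [leRHS]mulrC; apply: ler_wpM2l; first exact: normr_ge0.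
rewrite !mulrA; apply: (@le_trans _ _ ((nc ^ t)%:R / (nc ^_ t)%:R / d%:R)).
  rewrite -[leRHS]mulr1; apply: ler_wpM2l; first by rewrite !mulr_ge0 ?invr_ge0 ?ler0n.
  have [->|n0] := posnP (auto_count h); first by rewrite invr0 ler01.
  by rewrite invf_le1 ?ltr0n // ler1n.
apply: ler_wpM2r; first by rewrite invr_ge0 ler0n.
rewrite ler_pdivrMr ?ltr0n ?ffact_gt0 // -natrM ler_nat.
exact: expn_le_ffact.
Qed.

Unset Implicit Arguments.

Theorem theorem3p15 (R : realType) (t k : nat) (h : rel 'I_t)
    (h_simple : simple_graph h) (h_conn : connected_graph h)
    (h_leaf : no_leaves h) (h_edges : #|edge_set h| = k) :
  exists K : R,
    forall (a : slot k -> 'I_t) (iota : 'I_t -> slot k)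
      (V : finType) (g : rel V) (d nc : nat) (B : {fset 'M[R[i]]_d})
      (FX : free_slot a iota -> hash_family V 'M[R[i]]_d)
      (FC : hash_family V 'I_nc) (alpha : R),
    let m := #|directed_edges g| in
    is_orientation h a ->
    (forall b, iota b \in Gamma a b) ->
    simple_graph g ->
    admissible_group B ->
    (forall i, kwise_independent R (4 * k) (FX i) /\ uniform_on R B (FX i)) ->
    kwise_independent R (4 * k) FC ->
    uniform_on R [fset c | c in 'I_nc]%fset FC ->
    0 < alpha ->
    (max_degree g)%:R <= powR m%:R (2^-1 - alpha) ->
    (t <= nc)%N ->
    nc%:R <= Num.min (powR m%:R (2 * alpha)) (powR m%:R 3^-1) ->
    variance (fun w : sample FX FC => estimator h g w) <=
      (K * ((subgraph_count h g)%:R ^+ 2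
            + m%:R ^+ k / (d%:R * nc%:R ^+ (2 * k - t))))%:C.
Proof.
pose P : R := #|{: {ffun (slot k * bool) * (slot k * bool) -> bool}}|%:R.
(* The outer [t ^ t] bounds the normalization of the estimator, the inner one the number of
   embeddings with a given image; [P] bounds the number of coincidence patterns. Both are squared
   because of the second moment, and all depend on [h] only. *)
exists ((t ^ t)%:R ^+ 2 * ((t ^ t)%:R ^+ 2 + P)).
move=> a iota V g d nc B FX FC alpha m a_or iG g_simple adm FX_hash FCk FCu _ leDelta
  t_nc le_nc.
have B_char := admissible_character_group adm.
have FX_unif j := (FX_hash j).2; have FX_kwise j := (FX_hash j).1.
have t0 : (0 < t)%N by have [] := h_conn; rewrite card_ord.
have k0 : (0 < k)%N.
  by case: (iota (Ordinal t0)) => i _; apply: leq_ltn_trans (ltn_ord i).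
have nc0 : (0 < nc)%N by apply: leq_trans t_nc.
have [m0 c3 leD] := density_bounds nc0 leDelta le_nc.
have mN : (0 < m)%N by rewrite -(ltr0n R).
(* A vertex of G is needed to deduce from uniformity that the seed types, and with them the sample
   space, are not empty. *)
have /card_gt0P[e0 _] := mN; pose v0 := e0.1.
have FX_in j v (s : seed (FX j)) : hash s v \in B.
  exact: (hash_in (cg_ex B_char) (FX_unif j)).
have S0 : (0 < #|{: sample FX FC}|)%N.
  have ex j : exists s : seed (FX j), true.
    by have /card_gt0P[s _] := seed_gt0 (cg_ex B_char) (FX_unif j) v0; exists s.
  have c_ex : exists c, c \in [fset c | c in 'I_nc]%fset.
    by exists (Ordinal nc0); rewrite !inE.
  have /card_gt0P[sC _] := seed_gt0 c_ex FCu v0.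
  apply/card_gt0P.
  by exists ((finfun (fun j => xchoose (ex j)) : {dffun forall j, seed (FX j)}), sC).
have dR : 0 < d%:R :> R by rewrite ltr0n (cg_dim B_char).
have ncR : 0 < nc%:R :> R by rewrite ltr0n.
set N := subgraph_count h g.
set X : R := m%:R ^+ k / nc%:R ^+ (2 * k - t).
have X0 : 0 <= X by rewrite divr_ge0 ?exprn_ge0.
pose W := color_weight R a FC.
have W0 o : 0 <= W o by apply: color_weight_ge0.
pose T (o : {ffun 'I_k -> V * V} * {ffun 'I_k -> V * V}) : R[i] :=
  \sum_p \sum_q pair_moment FX o p q.
have n4 : (4 <= 4 * k)%N by lia.
have moment : expectation (fun w : sample FX FC => `|\tr (Ssum g w)| ^+ 2) <=
    ((d%:R * (t ^ t * N)%:R) ^+ 2 + d%:R * (P * X))%:C.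
  rewrite (second_moment_trace g FC iG B_char FX_in).
  (* The weight of a pair of walks: all d^2 character pairs may survive when every vertex is pure,
     at most d otherwise. Terms with vanishing moment are dropped, so that the remaining pairs are
     known to be paired. *)
  pose b o : R := if all_pure a iota o then d%:R ^+ 2 * W o else
                  if T o != 0 then d%:R * W o else 0.
  apply: (@le_trans _ _ (\sum_(o | walk_pair g o) (b o)%:C)).
    (* The individual terms are complex, but the whole sum is a second moment and thus real and
       nonnegative; it may be replaced by its norm and estimated termwise. *)
    apply: le_trans (real_ler_norm _) _.
      rewrite -(second_moment_trace g FC iG B_char FX_in) ger0_real //.
      by rewrite mulr_ge0 ?invr_ge0 ?ler0n // sumr_ge0 // => w _; rewrite exprn_ge0.
    apply: le_trans (ler_norm_sum _ _ _) _.
    apply: ler_sum => o _.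
    have -> : \sum_(c : {ffun 'I_t -> 'I_nc} | injectiveb c)
      \sum_(c' : {ffun 'I_t -> 'I_nc} | injectiveb c')
      (Pr R [pred s : seed FC | compatible a c o.1 s && compatible a c' o.2 s])%:C
      = (W o)%:C.
      rewrite /W /color_weight rmorph_sum; apply: eq_bigr => c _.
      by rewrite rmorph_sum.
    rewrite normrM -/(T o) ger0_norm ?lecR //.
    have Wc : 0 <= (W o)%:C by rewrite lecR.
    rewrite /b; case: ifP => pu.
      rewrite mulrC rmorphM rmorphXn /= rmorph_nat -natrX; apply: ler_wpM2r => //.
      exact: pair_moment_sum_le B_char FX_unif o.
    have [->|nT] := eqVneq (T o) 0; first by rewrite normr0 mulr0.
    rewrite mulrC rmorphM /= rmorph_nat; apply: ler_wpM2r => //.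
    apply: (pair_moment_sum_notpure B_char FX_unif FX_kwise n4).
    by rewrite -/(all_pure _ _ _) pu.
  rewrite -rmorph_sum lecR (bigID (@all_pure _ _ a iota V)) /= lerD //.
    apply: (@le_trans _ _ (\sum_(o in [set o | [&& walk_pair g o, all_pure a iota o &
        color_weight R a FC o != 0]]) d%:R ^+ 2)).
      rewrite big_mkcond [leRHS]big_mkcond /=; apply: ler_sum => o _.
      rewrite inE /b; case: (walk_pair g o) => //=; case: (all_pure a iota o) => //=.
      have [e|n0] := eqVneq (color_weight R a FC o) 0.
        by rewrite /W e mulr0.
      rewrite -[leRHS]mulr1 ler_wpM2l ?exprn_ge0 //.
      exact: color_weight_le1.
    rewrite sumr_const -[leLHS]mulr_natr exprMn ler_wpM2l ?exprn_ge0 // -natrX ler_nat.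
    exact: card_pure_pairs.
  apply: (@le_trans _ _ (d%:R * \sum_(o in [set o | [&& walk_pair g o,
      ~~ all_pure a iota o & T o != 0]]) W o)).
    rewrite mulr_sumr big_mkcond [leRHS]big_mkcond /=; apply: ler_sum => o _.
    rewrite inE /b; case: (walk_pair g o) => //=; case: (all_pure a iota o) => //=.
  apply: ler_wpM2l; first exact: ltW.
  apply: (sum_paired_pairs h_simple h_conn h_leaf a_or iG g_simple FCk FCu) => // o.
  rewrite inE => /and3P[wo npo nT]; split=> //.
  exact: (pair_moment_sum_paired B_char FX_unif FX_kwise n4 nT).
apply: le_trans (variance_le _ S0) _.
apply: (@le_trans _ _ (expectation (fun w : sample FX FC =>
   ((t ^ t)%:R / d%:R) ^+ 2 * `|\tr (Ssum g w)| ^+ 2))).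
  by apply: le_expectation => w; apply: norm_estimator_le.
rewrite expectationZ.
have zc : ((t ^ t)%:R / d%:R) ^+ 2 = (((t ^ t)%:R / d%:R) ^+ 2)%:C :> R[i].
  by rewrite [RHS]rmorphXn /= fmorph_div /= !rmorph_nat.
rewrite zc; apply: le_trans (ler_wpM2l _ moment) _.
  by rewrite lecR exprn_ge0 // divr_ge0 ?ler0n.
rewrite -rmorphM lecR natrM.
have -> : m%:R ^+ k / (d%:R * nc%:R ^+ (2 * k - t)) = X / d%:R.
  by rewrite invfM mulrA mulrAC.
set z := (t ^ t)%:R; set y := N%:R.
have -> : (z / d%:R) ^+ 2 * ((d%:R * (z * y)) ^+ 2 + d%:R * (P * X)) =
    z ^+ 2 * (z ^+ 2 * y ^+ 2 + P * (X / d%:R)).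
  by field; rewrite gt_eqF.
rewrite -mulrA; apply: ler_wpM2l; first by rewrite exprn_ge0 ?ler0n.
have P0 : 0 <= P by exact: ler0n.
have Xd : 0 <= X / d%:R by rewrite divr_ge0 // ltW.
have y0 : 0 <= y ^+ 2 by rewrite exprn_ge0 ?ler0n.
have z0 : 0 <= z ^+ 2 by rewrite exprn_ge0 ?ler0n.
rewrite mulrDl; apply: lerD.
  by apply: ler_wpM2l; rewrite // lerDl.
by apply: ler_wpM2l; rewrite // lerDr.
Qed.
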